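(* As $q\to\infty$, $$\Lambda_q \leq \sqrt{\frac{6}{\pi q}} + O(q^{-3/2}),$$ that is, there exist constants $C>0$ and $q_0>2$ such that $\Lambda_q \le \sqrt{\frac{6}{\pi q}} + C q^{-3/2}$ for all real $q\ge q_0$.
   Context: The Fourier transform is $\widehat f(\xi) = \int_{\mathbb{R}} f(x)e^{-2\pi i x\xi}\, dx$ (extended to $L^2(\mathbb{R})$ as usual). The Paley--Wiener space is $PW^2 := \{f\in L^2(\mathbb{R}): \operatorname{supp}\widehat f\subset[-1/2,1/2]\}$ (complex-valued functions). For $s>0$, $\lambda(s):=\sup_{f\in PW^2,\ \lVert f\rVert_2=1} \int_{-s/2}^{s/2}|f(x)|^2\, dx$. The function $\lambda$ is non-decreasing, and it is well known that it is real-analytic on $(0,\infty)$; $\lambda'$ denotes its derivative (so $\lambda'\ge 0$). For $q>2$, $\Lambda_q := \int_0^{\infty} (\lambda'(x))^{q/2}\,dx$. *)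

(* Defs.v *)
From HB Require Import structures.
From mathcomp Require Import all_boot all_order all_algebra.
From mathcomp Require Import complex.
From mathcomp Require Import all_classical all_reals all_analysis.

Set Implicit Arguments.
Unset Strict Implicit.
Unset Printing Implicit Defensive.

Import Order.TTheory GRing.Theory Num.Theory.
Import numFieldNormedType.Exports.

Local Open Scope classical_set_scope.
Local Open Scope ring_scope.
Local Open Scope complex_scope.

(* The library has no Lebesgue integral for complex-valued functions, so
   measurability, integrability and integrals of functions R -> R[i] are taken
   componentwise. *)
Section PaleyWiener.
Variable R : realType.
Implicit Types (f g : R -> R[i]) (s x xi : R).

Local Notation mu := (@lebesgue_measure R).

Definition cmeasurable f : Prop :=
  measurable_fun [set: R] (fun x => complex.Re (f x)) /\
  measurable_fun [set: R] (fun x => complex.Im (f x)).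

Definition cL1 f : Prop :=
  mu.-integrable [set: R] (fun x => (complex.Re (f x))%:E) /\
  mu.-integrable [set: R] (fun x => (complex.Im (f x))%:E).

Definition cintegral f : R[i] :=
  (\int[mu]_x complex.Re (f x)) +i* (\int[mu]_x complex.Im (f x)).

Definition L2norm f : \bar R := Lnorm mu 2%:E (fun x => (Normc.normc (f x))%:E).

Definition cL2 f : Prop := cmeasurable f /\ (L2norm f < +oo)%E.

(* e^(i t) *)
Definition cis (t : R) : R[i] := cos t +i* sin t.

Definition fourier f : R -> R[i] :=
  fun xi => cintegral (fun x => f x * cis (- (2 * pi * x * xi))).

(* [g] represents the Fourier transform of [f] in L^2, i.e. the continuous
   extension to L^2 of [fourier] restricted to the dense subspace of L^1 and L^2.
   It is a relation because [g] is only determined almost everywhere. *)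
Definition is_fourierL2 f g : Prop :=
  [/\ cL2 f, cL2 g &
    exists u : nat -> R -> R[i],
      [/\ forall n, cL1 (u n) /\ cL2 (u n),
          (fun n => L2norm (fun x => u n x - f x)) @ \oo --> (0 : \bar R) &
          (fun n => L2norm (fun xi => fourier (u n) xi - g xi)) @ \oo
            --> (0 : \bar R)] ].

(* Support of a function defined up to null sets: the complement of the largest
   open set on which it vanishes almost everywhere. *)
Definition esssupp g : set R :=
  [set x | forall U : set R, nbhs x U -> ~ {ae mu, forall y, U y -> g y = 0}].

Definition PW2 : set (R -> R[i]) :=
  [set f | exists2 g, is_fourierL2 f g & esssupp g `<=` `[- (1 / 2), 1 / 2] ].

Definition concentration s f : R :=
  \int[mu]_(x in `[- (s / 2), s / 2]) (Normc.normc (f x) ^+ 2).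

(* [sup] is real-valued; for 0 < s the set is nonempty and bounded above by 1. *)
Definition lambda s : R :=
  sup [set concentration s f | f in [set f | PW2 f /\ L2norm f = 1%E] ].

Definition Lambda (q : R) : \bar R :=
  (\int[mu]_(x in `]0%R, +oo[) ((derive1 (lambda : R -> R) x) `^ (q / 2))%:E)%E.

End PaleyWiener.

(* Main.v *)
(** Let [f] be in PW^2 with norm 1 and let [g] be its Fourier transform, which
    vanishes outside [-1/2, 1/2]. By inversion [f (x)] and [f (- x)] are the
    sum and the difference of the cosine and ([i] times the) sine coefficients
    of [g] at frequency [x]. These two functions are orthogonal on the symmetric
    interval [-1/2, 1/2], where the larger of their squared norms is
    [(1 + |sinc (2 x)|) / 2], so Bessel's inequality gives
    [|f x|^2 + |f (- x)|^2 <= 1 + |sinc (2 x)|] for almost every [x > 0].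
    Integrating over [s/2 < x < t/2] bounds [lambda t - lambda s] without any
    recourse to extremal functions, whence
    [lambda' s <= (1 + |sinc s|) / 2 = 1 - (pi s)^2 / 12 + O (s^4)]
    wherever the derivative exists. On [0, 1] the integral of the [q/2]-th power
    is then a Gaussian integral up to a relative error [O (1/q)]; beyond 1,
    [lambda' <= 3/4] and the integral of [lambda'] is at most 1, so that the
    contribution is exponentially small.

    Inversion is obtained by Abel summation: the weight [exp (- e |xi|)] has the
    Poisson kernel as its Fourier transform. For [u] in L^1 and L^2, the weighted
    integral of [|u^|^2] is the pairing of [u] with its Poisson integral, hence at
    most the squared norm of [u]; letting [e] go to 0 gives the Plancherel
    inequality, which passes to L^2. Poisson integrals converge to [f] at its
    Lebesgue points. *)

Require Import Defs.
From HB Require Import structures.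
From mathcomp Require Import all_boot all_order all_algebra.
From mathcomp Require Import complex.
From mathcomp Require Import all_classical all_reals all_analysis.
From mathcomp Require Import measurable_realfun.
From mathcomp Require Import ring lra.

Set Implicit Arguments.
Unset Strict Implicit.
Unset Printing Implicit Defensive.

Import Order.TTheory GRing.Theory Num.Theory.
Import numFieldNormedType.Exports.

Local Open Scope classical_set_scope.
Local Open Scope ring_scope.

(** * Square-integrable functions *)

Section square_integrable.
Context {R : realType}.
Implicit Types f g h : R -> R.
Notation mu := (@lebesgue_measure R).

(** The obstacle is that [lambda] is known only as a supremum. Its derivative is [derive1], which
    returns 0 where the limit fails to exist; so a statement about [lambda'] is either trivial at a
    point or a limit of difference quotients with steps [1 / (n + 1)]. For the same reason the
    integral of [lambda'] is not computed by the fundamental theorem of calculus: Fatou's lemma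
    produces a measurable majorant instead, and the last comparison of integrals rests on
    monotonicity alone.

    The constant arises as follows. Raising [1 - (pi s)^2 / 12] to the power [q / 2] gives the
    Gaussian [exp (- q (pi s)^2 / 24)], whose integral over the half-line is [sqrt (6 / (pi q))].
    The quartic term contributes [q s^4] to the exponent; as [s^2] is of order [1 / q] under the
    Gaussian, it is a relative error of order [1 / q].

    Analysis is done on real and imaginary parts with real cosine and sine transforms. This suits
    the argument, because the even and odd parts of [f] are what these two transforms see. *)

Definition L1 f : Prop := mu.-integrable [set: R] (EFin \o f).

Definition L2 f : Prop :=
  measurable_fun [set: R] f /\ L1 (fun x => f x ^+ 2).

Lemma L1_measurable f : L1 f -> measurable_fun [set: R] f.
Proof. by move/(measurable_int mu)/measurable_EFinP. Qed.

Lemma L1_le f g : measurable_fun [set: R] f -> L1 g ->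
  (forall x, `|f x| <= g x) -> L1 f.
Proof.
move=> mf ig fg; apply: (@le_integrable _ _ _ mu _ _ _ (EFin \o g)) => //.
  exact/measurable_EFinP.
by move=> x _; rewrite /= lee_fin (le_trans (fg x)) ?ler_norm.
Qed.

Lemma L1D f g : L1 f -> L1 g -> L1 (fun x => f x + g x).
Proof. by move=> f1 g1; have := integrableD measurableT f1 g1. Qed.

Lemma L1B f g : L1 f -> L1 g -> L1 (fun x => f x - g x).
Proof. by move=> f1 g1; have := integrableB measurableT f1 g1. Qed.

Lemma L1Z k f : L1 f -> L1 (fun x => k * f x).
Proof. by move=> f1; have := integrableZl measurableT k f1. Qed.

Lemma L1_norm f : L1 f -> L1 (fun x => `|f x|).
Proof. by move=> ?; exact: integrable_norm. Qed.

Lemma L1_bounded f h M : L1 f -> measurable_fun [set: R] h ->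
  (forall x, `|h x| <= M) -> L1 (fun x => f x * h x).
Proof.
move=> f1 mh hM; apply: (@L1_le _ (fun x => M * `|f x|)).
- by apply: measurable_funM => //; exact: L1_measurable.
- exact/L1Z/L1_norm.
- by move=> x; rewrite normrM mulrC ler_wpM2r.
Qed.

Lemma L2M f g : L2 f -> L2 g -> L1 (fun x => f x * g x).
Proof.
move=> [mf f2] [mg g2]; apply: (@L1_le _ (fun x => f x ^+ 2 + g x ^+ 2)).
- exact: measurable_funM.
- exact: L1D.
- by move=> x; rewrite ler_norml; apply/andP; split; nra.
Qed.

Lemma L2D f g : L2 f -> L2 g -> L2 (fun x => f x + g x).
Proof.
move=> [mf f2] [mg g2]; split; first exact: measurable_funD.
apply: (@L1_le _ (fun x => 2 * (f x ^+ 2 + g x ^+ 2))).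
- by apply: measurable_funX; exact: measurable_funD.
- exact/L1Z/L1D.
- move=> x; rewrite ger0_norm ?sqr_ge0// -subr_ge0.
  have -> : 2 * (f x ^+ 2 + g x ^+ 2) - (f x + g x) ^+ 2 = (f x - g x) ^+ 2 by ring.
  exact: sqr_ge0.
Qed.

Lemma L2_bounded f h M : L2 f -> measurable_fun [set: R] h ->
  (forall x, `|h x| <= M) -> L2 (fun x => f x * h x).
Proof.
move=> [mf f2] mh hM; split; first exact: measurable_funM.
have -> : (fun x => (f x * h x) ^+ 2) = (fun x => f x ^+ 2 * h x ^+ 2).
  by apply/funext => x; rewrite exprMn.
apply: (@L1_bounded _ _ (M ^+ 2)) => //; first exact: measurable_funX.
move=> x; rewrite normrX ler_pXn2r// nnegrE//.
exact: le_trans (normr_ge0 _) (hM x).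
Qed.

Lemma L2Z k f : L2 f -> L2 (fun x => k * f x).
Proof.
move=> f2; have := @L2_bounded f (cst k) `|k| f2 (measurable_cst _).
by under eq_fun do rewrite mulrC; apply.
Qed.

Lemma L2N f : L2 f -> L2 (fun x => - f x).
Proof. by move/(L2Z (-1)); under eq_fun do rewrite mulN1r. Qed.

Lemma L2B f g : L2 f -> L2 g -> L2 (fun x => f x - g x).
Proof. by move=> f2 g2; apply: L2D => //; exact: L2N. Qed.

Lemma L1_L2_bounded f M : L1 f -> (forall x, `|f x| <= M) -> L2 f.
Proof.
move=> f1 fM; split; first exact: L1_measurable.
by apply: (@L1_bounded _ _ M) => //; exact: L1_measurable.
Qed.

(** The polynomial [t -> \int (f + t g)^2] is nonnegative. When [c > 0] its value at [- b / c] gives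
    the claim; when [c = 0] it is affine in [t], which forces [b = 0]. *)
Lemma Cauchy_Schwarz f g : L2 f -> L2 g ->
  (\int[mu]_x (f x * g x)) ^+ 2 <=
  \int[mu]_x (f x ^+ 2) * \int[mu]_x (g x ^+ 2).
Proof.
move=> f2 g2; have fg := L2M f2 g2.
set a := \int[mu]_x (f x ^+ 2); set b := \int[mu]_x (f x * g x).
set c := \int[mu]_x (g x ^+ 2).
have c0 : 0 <= c by apply: Rintegral_ge0 => x _; exact: sqr_ge0.
have H t : 0 <= a + (2 * t * b + t ^+ 2 * c).
  have -> : a + (2 * t * b + t ^+ 2 * c) = \int[mu]_x ((f x + t * g x) ^+ 2).
    have -> : (fun x => (f x + t * g x) ^+ 2) =
        (fun x => f x ^+ 2 + (2 * t * (f x * g x) + t ^+ 2 * g x ^+ 2)).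
      by apply/funext => x; ring.
    rewrite RintegralD//; first last.
    - by apply: L1D; apply: L1Z => //; exact: g2.2.
    - exact: f2.2.
    rewrite RintegralD//; [|exact: L1Z|by apply: L1Z; exact: g2.2].
    by rewrite !RintegralZl//; exact: g2.2.
  by apply: Rintegral_ge0 => x _; exact: sqr_ge0.
move: c0; rewrite le_eqVlt => /predU1P[c0|c0]; last first.
  have := H (- b / c).
  have -> : a + (2 * (- b / c) * b + (- b / c) ^+ 2 * c) = (a * c - b ^+ 2) / c.
    by field; rewrite gt_eqF.
  by rewrite pmulr_lge0 ?invr_gt0// subr_ge0.
have [->|b0] := eqVneq b 0; first by rewrite -c0 mulr0 expr0n.
(* The parameter at which the affine function [a + 2 t b] takes the value -1. *)
have := H (- (a + 1) / (2 * b)).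
rewrite -c0 mulr0 addr0.
have -> : 2 * (- (a + 1) / (2 * b)) * b = - (a + 1) by field.
by move=> ?; exfalso; lra.
Qed.

End square_integrable.

(** * Measure-preserving maps and Fubini *)

Section measure_preserving.
Context {R : realType}.
Implicit Types f : R -> R.
Notation mu := (@lebesgue_measure R).

Definition preserves_lebesgue (phi : R -> R) : Prop :=
  measurable_fun [set: R] phi /\
  forall A : set R, measurable A -> mu (phi @^-1` A) = mu A.

Lemma preserves_lebesgue_opp : preserves_lebesgue -%R.
Proof.
split; first exact: oppr_measurable.
by move=> A mA; exact: lebesgue_measureN.
Qed.

Lemma preserves_lebesgue_shift (c : R) : preserves_lebesgue (fun x => x + c).
Proof.
have mc : measurable_fun [set: R] (fun x : R => x + c) by exact: measurable_funD.
split=> // A mA.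
(* The image measure gives half-open intervals their length, so uniqueness identifies it with
   Lebesgue measure. *)
pose m := pushforward mu (fun x : measurableTypeR R => x + c : measurableTypeR R).
have -> : mu ((fun x => x + c) @^-1` A) = m A by [].
apply/esym/lebesgue_measure_unique => //= _ [[a b]] _ <-.
rewrite /m /pushforward.
have -> : (fun x : R => x + c) @^-1` `]a, b] = `]a - c, b - c]%classic.
  by apply/seteqP; split => x /=; rewrite !in_itv/= ltrBlDr lerBrDr.
by rewrite !lebesgue_measure_itv/= !lte_fin ltrD2r -!EFinB opprB addrA subrK.
Qed.

Lemma ge0_integral_preserving (phi : R -> R) (f : R -> \bar R) (D : set R) :
  preserves_lebesgue phi -> measurable D -> measurable_fun D f ->
  (forall x, D x -> 0 <= f x)%E ->
  (\int[mu]_(x in phi @^-1` D) f (phi x) = \int[mu]_(x in D) f x)%E.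
Proof.
move=> [mphi pphi] mD mf f0.
rewrite -(@ge0_integral_pushforward _ _ (measurableTypeR R) (measurableTypeR R) _ _ mphi mu D f)//; last first.
  by move=> y; rewrite inE; exact: f0.
by apply: eq_measure_integral => A mA _; exact: pphi.
Qed.

Lemma L1_preserving (phi : R -> R) f : preserves_lebesgue phi ->
  L1 f -> L1 (fun x => f (phi x)).
Proof.
move=> pphi /integrableP[mf foo]; have [mphi _] := pphi.
apply/integrableP; split; first exact: measurableT_comp mf mphi.
have := @ge0_integral_preserving phi (fun x => `|(f x)%:E|)%E setT pphi measurableT.
rewrite preimage_setT => -> //; exact: measurableT_comp.
Qed.

Lemma Rintegral_preserving (phi : R -> R) f : preserves_lebesgue phi ->
  L1 f -> \int[mu]_x f (phi x) = \int[mu]_x f x.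
Proof.
move=> pphi f1; have [mphi ephi] := pphi; congr fine.
have := @integral_pushforward _ _ (measurableTypeR R) (measurableTypeR R) _ _ mphi mu setT (EFin \o f).
rewrite preimage_setT => <- //; last 2 first.
- exact: measurable_int f1.
- exact: L1_preserving.
by apply: eq_measure_integral => A mA _; exact: ephi.
Qed.

Lemma ae_preserving (phi : R -> R) (P : R -> Prop) : preserves_lebesgue phi ->
  {ae mu, forall x, P x} -> {ae mu, forall x, P (phi x)}.
Proof.
move=> [mphi ephi] [A [mA A0 PA]]; exists (phi @^-1` A); split.
- by rewrite -[X in measurable X]setTI; exact: mphi.
- by rewrite ephi.
- by move=> x /= nP; exact: PA.
Qed.

Lemma preserves_lebesgue_reflect (c : R) : preserves_lebesgue (fun x => c - x).
Proof.
have [mo eo] := preserves_lebesgue_opp.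
have [ms es] := preserves_lebesgue_shift c.
have E : (fun x => c - x) = (fun x => x + c) \o -%R.
  by apply/funext => x /=; rewrite addrC.
split; first by rewrite E; exact: measurableT_comp.
move=> A mA; rewrite E comp_preimage eo ?es//.
by rewrite -[X in measurable X]setTI; exact: ms.
Qed.

End measure_preserving.

(** * Fubini for a bounded kernel between two integrable functions *)

Section fubini.
Context {R : realType}.
Implicit Types a phi : R -> R.
Notation mu := (@lebesgue_measure R).

Lemma integrable_tensor a phi (k : R * R -> R) : L1 a -> L1 phi ->
  measurable_fun [set: R * R] k -> (forall z, `|k z| <= 1) ->
  (mu \x mu)%E.-integrable [set: R * R]
    (fun z => (a z.1 * (phi z.2 * k z))%:E).
Proof.
move=> a1 phi1 mk k1.
have ma := L1_measurable a1; have mphi := L1_measurable phi1.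
have mK : measurable_fun [set: R * R]
    (fun z => (a z.1 * (phi z.2 * k z))%:E).
  apply/measurable_EFinP; apply: measurable_funM.
    exact: measurableT_comp ma measurable_fst.
  by apply: measurable_funM => //; exact: measurableT_comp mphi measurable_snd.
apply/integrable12ltyP => //.
apply: (@le_lt_trans _ _
  (\int[mu]_x (`|(a x)%:E| * \int[mu]_y `|(phi y)%:E|))%E); last first.
  rewrite ge0_integralZr//; last first.
  - exact: integral_ge0.
  - by apply: measurableT_comp => //; exact/measurable_EFinP.
  move: a1 phi1 => /integrableP[_ a1] /integrableP[_ phi1].
  by rewrite lte_mul_pinfty ?ge0_fin_numE ?integral_ge0.
have H x : (\int[mu]_y `|(a (x, y).1 * (phi (x, y).2 * k (x, y)))%:E| <=
   `|(a x)%:E| * \int[mu]_y `|(phi y)%:E|)%E.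
  rewrite -ge0_integralZl//; last first.
    by apply: measurableT_comp => //; exact/measurable_EFinP.
  apply: ge0_le_integral => //=.
  - apply/measurable_EFinP; apply: measurableT_comp => //.
    exact: (measurable_funM (measurable_cst (a x))
      (measurable_funM mphi (measurableT_comp mk (measurable_pair1 x)))).
  - by apply: measurable_funeM; apply/measurable_EFinP; exact: measurableT_comp.
  - move=> y _; rewrite lee_fin !normrM ler_wpM2l//.
    by rewrite -[leRHS]mulr1 ler_wpM2l.
apply: ge0_le_integral => //.
- by move=> x _; apply: integral_ge0.
- apply: (@measurable_fun_fubini_tonelli_F _ _ (measurableTypeR R) (measurableTypeR R) R mu
    (fun z => `|(a z.1 * (phi z.2 * k z))%:E|)%E) => //.
  exact: measurableT_comp.
- apply: emeasurable_funM => //; apply: measurableT_comp => //.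
  exact/measurable_EFinP.
Qed.

Lemma Fubini_tensor a phi (k : R * R -> R) : L1 a -> L1 phi ->
  measurable_fun [set: R * R] k -> (forall z, `|k z| <= 1) ->
  \int[mu]_xi (phi xi * \int[mu]_y (a y * k (y, xi))) =
  \int[mu]_y (a y * \int[mu]_xi (phi xi * k (y, xi))).
Proof.
move=> a1 phi1 mk k1; rewrite /Rintegral; congr fine.
have I := integrable_tensor a1 phi1 mk k1.
have ka y : L1 (fun xi => phi xi * k (y, xi)).
  apply: (@L1_bounded _ _ _ 1) => //.
  by have := measurableT_comp mk (measurable_pair1 y).
have kphi xi : L1 (fun y => a y * k (y, xi)).
  apply: (@L1_bounded _ _ _ 1) => //.
  by have := measurableT_comp mk (measurable_pair2 xi).
transitivity (\int[mu]_xi \int[mu]_y (a y * (phi xi * k (y, xi)))%:E)%E.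
  apply: eq_integral => xi _.
  rewrite EFinM fineK; last exact: integrable_fin_num (kphi xi).
  rewrite -integralZl//; last exact: kphi.
  by apply: eq_integral => y _; rewrite -EFinM mulrCA.
rewrite -(Fubini I); apply: eq_integral => y _ /=.
rewrite EFinM fineK; last exact: integrable_fin_num (ka y).
by rewrite -integralZl//; exact: ka.
Qed.

(** A bounded kernel is not integrable over the whole second variable, so Fubini does not apply
    directly. A Gaussian weight in [xi] restores integrability; as it never vanishes, it can be
    divided out of the measurable result. *)
Lemma measurable_kernel_integral a (k : R * R -> R) : L1 a ->
  measurable_fun [set: R * R] k -> (forall z, `|k z| <= 1) ->
  measurable_fun [set: R] (fun xi => \int[mu]_y (a y * k (y, xi))).
Proof.
move=> a1 mk k1.
pose phi (x : R) := gauss_fun x.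
have phi1 : L1 phi by exact: integrableT_gauss.
have kphi xi : L1 (fun y => a y * k (y, xi)).
  apply: (@L1_bounded _ _ _ 1) => //.
  by have := measurableT_comp mk (measurable_pair2 xi).
have /measurable_EFinP H : measurable_fun [set: R]
    (EFin \o (fun xi => phi xi * \int[mu]_y (a y * k (y, xi)))).
  have := measurable_fubini_G (integrable_tensor a1 phi1 mk k1).
  congr (measurable_fun _ _); apply/funext => xi /=.
  rewrite EFinM fineK; last exact: integrable_fin_num (kphi xi).
  rewrite -integralZl//; last exact: kphi.
  by apply: eq_integral => y _; rewrite -EFinM mulrCA.
have -> : (fun xi => \int[mu]_y (a y * k (y, xi))) =
   (fun xi => expR (xi ^+ 2) * (phi xi * \int[mu]_y (a y * k (y, xi)))).
  apply/funext => xi; rewrite mulrA /phi /gauss_fun expRN divff ?mul1r//.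
  by rewrite gt_eqF ?expR_gt0.
apply: measurable_funM => //.
by apply: measurableT_comp => //; exact: measurable_funX.
Qed.

End fubini.

(** * The Poisson kernel *)

Section derivative_rules.
Context {R : realType}.
Implicit Types (f g : R -> R) (x : R).

Lemma is_derive_mul f g x (df dg : R) :
  is_derive x (1 : R) f df -> is_derive x (1 : R) g dg ->
  is_derive x (1 : R) (fun y => f y * g y) (df * g x + f x * dg).
Proof.
move=> Df Dg; have := is_deriveM Df Dg.
by congr is_derive; rewrite addrC /GRing.scale/= [g x * _]mulrC.
Qed.

Lemma is_derive_add f g x (df dg : R) :
  is_derive x (1 : R) f df -> is_derive x (1 : R) g dg ->
  is_derive x (1 : R) (fun y => f y + g y) (df + dg).
Proof. by move=> Df Dg; have := is_deriveD Df Dg. Qed.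

Lemma is_derive_scale f x (k df : R) : is_derive x (1 : R) f df ->
  is_derive x (1 : R) (fun y => k * f y) (k * df).
Proof.
move=> Df; have := is_derive_mul (is_derive_cst k x (1 : R)) Df.
by rewrite mul0r add0r.
Qed.

Lemma is_derive_comp f g x (df dg : R) :
  is_derive (g x) (1 : R) f df -> is_derive x (1 : R) g dg ->
  is_derive x (1 : R) (fun y => f (g y)) (df * dg).
Proof. by move=> Df Dg; have := is_derive1_comp Df Dg. Qed.

Lemma is_derive_linear (k x : R) : is_derive x (1 : R) (fun y => k * y) k.
Proof. by apply: is_derive_eq; rewrite scaler1. Qed.

Lemma is_derive_continuous f (df : R -> R) :
  (forall x, is_derive x (1 : R) f (df x)) -> continuous f.
Proof.
move=> Df x; apply: differentiable_continuous; apply/derivable1_diffP.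
by have [] := Df x.
Qed.

Lemma is_derive_derive1 f x (df : R) :
  is_derive x (1 : R) f df -> derive1 f x = df.
Proof. by move=> Df; rewrite derive1E; exact: derive_val. Qed.

End derivative_rules.

(** * Fundamental theorem of calculus on segments, half-lines and for even functions *)

Section ftc.
Context {R : realType}.
Implicit Types (f F : R -> R).
Notation mu := (@lebesgue_measure R).

Lemma FTC2_Rintegral f F (a b : R) : a < b -> continuous f ->
  (forall x, is_derive x (1 : R) F (f x)) ->
  \int[mu]_(x in `[a, b]) f x = F b - F a.
Proof.
move=> ab cf DF; rewrite /Rintegral (@continuous_FTC2 _ f F)//.
- exact: continuous_subspaceT.
- have cF := is_derive_continuous DF; split.
  + by move=> x _; have [] := DF x.
  + exact/cvg_at_right_filter/cF.
  + exact/cvg_at_left_filter/cF.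
- by move=> x _; exact: is_derive_derive1.
Qed.

Lemma FTC2y f F (a l : R) : (forall x, 0 <= f x) -> continuous f ->
  (forall x, is_derive x (1 : R) F (f x)) -> F x @[x --> +oo] --> l ->
  (\int[mu]_(x in `[a, +oo[) (f x)%:E = (l - F a)%:E)%E.
Proof.
move=> f0 cf DF Fl; have cF := is_derive_continuous DF.
rewrite (@ge0_continuous_FTC2y _ f F a l)//.
- exact: continuous_subspaceT.
- exact/cvg_at_right_filter/cF.
- by move=> x _; exact: is_derive_derive1.
Qed.

Lemma ge0_even_integral f F (l : R) : (forall x, 0 <= f x) -> continuous f ->
  (forall x, f (- x) = f x) ->
  (forall x, is_derive x (1 : R) F (f x)) -> F x @[x --> +oo] --> l ->
  (\int[mu]_x (f x)%:E = (2 * (l - F 0))%:E)%E.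
Proof.
move=> f0 cf ef DF Fl; rewrite ge0_symfun_integralT//; last by move=> x /=; rewrite ef.
rewrite (_ : [set x | _] = `[0, +oo[%classic); last first.
  by apply/seteqP; split => x/=; rewrite in_itv/= andbT.
by rewrite (FTC2y 0 f0 cf DF Fl) EFinM.
Qed.

End ftc.

(** * The Poisson kernel and the Abel weight *)

Section poisson_kernel.
Context {R : realType}.
Implicit Types (e x t w : R).
Notation mu := (@lebesgue_measure R).

(** The Poisson kernel of the upper half-plane at height [e / (2 * pi)]; with this scaling it is the
    transform of [abel e] itself, of total mass 1. *)
Definition poisson e t := 2 * e / (e ^+ 2 + (2 * pi * t) ^+ 2).

Definition abel e (xi : R) := expR (- (e * `|xi|)).

Lemma poisson_denom_gt0 e t : 0 < e -> 0 < e ^+ 2 + (2 * pi * t) ^+ 2.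
Proof. by move=> e0; rewrite ltr_pwDl ?exprn_gt0 ?sqr_ge0. Qed.

Lemma poisson_ge0 e t : 0 < e -> 0 <= poisson e t.
Proof.
by move=> e0; rewrite divr_ge0 ?mulr_ge0 ?(ltW (poisson_denom_gt0 _ _))// ltW.
Qed.

Lemma poissonN e t : poisson e (- t) = poisson e t.
Proof. by rewrite /poisson mulrN sqrrN. Qed.

Lemma poisson_le e t : 0 < e -> poisson e t <= 2 / e.
Proof.
move=> e0; rewrite ler_pdivrMr ?poisson_denom_gt0//.
have -> : 2 / e * (e ^+ 2 + (2 * pi * t) ^+ 2) = 2 * e + 2 / e * (2 * pi * t) ^+ 2.
  by field; rewrite gt_eqF.
by rewrite lerDl mulr_ge0 ?sqr_ge0// divr_ge0// ltW.
Qed.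

Lemma continuous_poisson e : 0 < e -> continuous (poisson e).
Proof.
move=> e0 t; apply: cvgM; first exact: cvg_cst.
apply: cvgV; first by rewrite gt_eqF ?poisson_denom_gt0.
apply: cvgD; first exact: cvg_cst.
apply: (@cvg_comp _ _ _ (fun t : R => 2 * pi * t) (fun u : R => u ^+ 2)).
  by apply: cvgM; [exact: cvg_cst|exact: cvg_id].
exact: exprn_continuous.
Qed.

Lemma integral_poisson e : 0 < e -> (\int[mu]_t (poisson e t)%:E = 1)%E.
Proof.
move=> e0; have pi0 : 0 < pi :> R by exact: pi_gt0.
pose F (t : R) : R := pi^-1 * atan (2 * pi / e * t).
have DF t : is_derive t (1 : R) F (poisson e t).
  have := is_derive_scale pi^-1 (is_derive_comp (is_derive1_atan (2 * pi / e * t))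
    (is_derive_linear (2 * pi / e) t)).
  congr is_derive; move: (poisson_denom_gt0 t e0) pi0; rewrite /poisson.
  move: (@pi R) => p d0 p0; field.
  by rewrite !gt_eqF.
have FL : F x @[x --> +oo] --> (1 / 2 : R).
  rewrite (_ : (1 / 2 : R) = pi^-1 * (pi / 2)); last first.
    by rewrite mulrA mulVf ?gt_eqF.
  apply: cvgM; first exact: cvg_cst.
  apply: (@cvg_comp _ _ _ (fun t : R => 2 * pi / e * t) (@atan R) _ _ _ _ (@cvgy_atan R)).
  by apply: gt0_cvgMry; rewrite ?divr_gt0 ?mulr_gt0//; exact: cvg_id.
rewrite (ge0_even_integral _ _ _ DF FL).
- by congr EFin; rewrite /F mulr0 atan0 mulr0 subr0 mulrCA divff// mulr1.
- by move=> t; exact: poisson_ge0.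
- exact: continuous_poisson.
- by move=> t; rewrite poissonN.
Qed.

Lemma L1_poisson e : 0 < e -> L1 (poisson e).
Proof.
move=> e0; apply/integrableP; split.
  apply/measurable_EFinP.
  exact: (continuous_measurable_fun (continuous_poisson e0)).
under eq_integral do rewrite /= ger0_norm ?poisson_ge0//.
by rewrite integral_poisson// ltry.
Qed.

Lemma integral_poisson_shift e x : 0 < e ->
  (\int[mu]_y (poisson e (x - y))%:E = 1)%E.
Proof.
move=> e0; have := @ge0_integral_preserving _ _ (EFin \o poisson e) setT
  (preserves_lebesgue_reflect x) measurableT.
rewrite preimage_setT => -> /=; first exact: integral_poisson.
  exact: measurable_int (L1_poisson e0).
by move=> t _; rewrite lee_fin poisson_ge0.
Qed.

Lemma L1_poisson_shift e x : 0 < e -> L1 (fun y => poisson e (x - y)).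
Proof.
by move=> e0; apply: L1_preserving; [exact: preserves_lebesgue_reflect|exact: L1_poisson].
Qed.

Lemma L2_poisson_shift e x : 0 < e -> L2 (fun y => poisson e (x - y)).
Proof.
move=> e0; apply: (@L1_L2_bounded _ _ (2 / e)); first exact: L1_poisson_shift.
by move=> y; rewrite ger0_norm ?poisson_ge0// poisson_le.
Qed.

Lemma abel_ge0 e xi : 0 <= abel e xi. Proof. exact: expR_ge0. Qed.

Lemma abel_le1 e xi : 0 < e -> abel e xi <= 1.
Proof. by move=> e0; rewrite -expR0 ler_expR oppr_le0 mulr_ge0// ltW. Qed.

Lemma continuous_abel e : continuous (abel e).
Proof.
move=> x; apply: (@continuous_comp _ _ _ (fun x : R => - (e * `|x|)) expR).
  apply: cvgN; apply: cvgM; first exact: cvg_cst.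
  exact: norm_continuous.
exact: continuous_expR.
Qed.

(** An antiderivative of [expR (- e * x) * (1 + cos (w * x))]. The summand 1 keeps the integrand
    nonnegative, as [FTC2y] requires. The case [w = 0] gives the mass of [abel e], and subtracting
    it leaves the cosine integral. *)
Let abelF e w (x : R) : R := - e^-1 * expR (- e * x) +
  (e ^+ 2 + w ^+ 2)^-1 * (expR (- e * x) * (- e * cos (w * x) + w * sin (w * x))).

Let is_derive_abelF e w x : 0 < e ->
  is_derive x (1 : R) (abelF e w) (expR (- e * x) * (1 + cos (w * x))).
Proof.
move=> e0.
have dE : is_derive x (1 : R) (fun x => expR (- e * x)) (expR (- e * x) * - e).
  exact: is_derive_comp (is_derive_expR _) (is_derive_linear _ _).
have dc : is_derive x (1 : R) (fun x => cos (w * x)) (- sin (w * x) * w).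
  exact: is_derive_comp (is_derive_cos _) (is_derive_linear _ _).
have ds : is_derive x (1 : R) (fun x => sin (w * x)) (cos (w * x) * w).
  exact: is_derive_comp (is_derive_sin _) (is_derive_linear _ _).
have := is_derive_add (is_derive_scale (- e^-1) dE)
  (is_derive_scale (e ^+ 2 + w ^+ 2)^-1 (is_derive_mul dE
    (is_derive_add (is_derive_scale (- e) dc) (is_derive_scale w ds)))).
congr is_derive.
have d0 : 0 < e ^+ 2 + w ^+ 2 by rewrite ltr_pwDl ?exprn_gt0 ?sqr_ge0.
by field; rewrite !gt_eqF.
Qed.

Let cvg_abelF e w : 0 < e -> abelF e w x @[x --> +oo] --> (0 : R).
Proof.
move=> e0; pose C : R := e^-1 + (e ^+ 2 + w ^+ 2)^-1 * (e + `|w|).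
have d0 : 0 < e ^+ 2 + w ^+ 2 by rewrite ltr_pwDl ?exprn_gt0 ?sqr_ge0.
have cE : C * expR (- e * x) @[x --> +oo] --> (0 : R).
  rewrite -(mulr0 C); apply: cvgM; first exact: cvg_cst.
  have -> : (fun x => expR (- e * x)) = (fun x => expR (- (e * x))).
    by apply/funext => x; rewrite mulNr.
  apply: (@cvg_comp _ _ _ (fun x : R => e * x) (fun y => expR (- y)) _ _ _ _ (@cvgr_expR R)).
  by apply: gt0_cvgMry => //; exact: cvg_id.
apply: (@squeeze_cvgr _ _ _ _ (fun x => - (C * expR (- e * x))) (fun x => C * expR (- e * x))) => //.
  apply: nearW => x; rewrite -ler_norml /abelF.
  rewrite (le_trans (ler_normD _ _))// /C mulrDl lerD//.
    by rewrite normrM normrN normfV !gtr0_norm ?expR_gt0.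
  rewrite normrM normfV (gtr0_norm d0) -mulrA ler_wpM2l ?invr_ge0 ?(ltW d0)//.
  rewrite normrM (gtr0_norm (expR_gt0 _)) mulrC ler_wpM2r ?expR_ge0//.
  rewrite (le_trans (ler_normD _ _))// !normrM normrN (gtr0_norm e0) lerD//.
    by rewrite ler_piMr ?(ltW e0)// cos_max.
  by rewrite ler_piMr// sin_max.
by rewrite -oppr0; exact: cvgN.
Qed.

Let integral_abel_1cos e w : 0 < e ->
  (\int[mu]_xi (abel e xi * (1 + cos (w * xi)))%:E =
    (2 * (e^-1 + e / (e ^+ 2 + w ^+ 2)))%:E)%E.
Proof.
move=> e0.
have cc : continuous (fun x : R => 1 + cos (w * x)).
  move=> x; apply: cvgD; first exact: cvg_cst.
  apply: (@continuous_comp _ _ _ (fun x : R => w * x) cos).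
    by apply: cvgM; [exact: cvg_cst|exact: cvg_id].
  exact: continuous_cos.
have c0 x : 0 <= 1 + cos (w * x) by have := cos_geN1 (w * x); lra.
rewrite ge0_symfun_integralT//.
- rewrite (_ : [set x | _] = `[0, +oo[%classic); last first.
    by apply/seteqP; split => x/=; rewrite in_itv/= andbT.
  transitivity (2%:E * \int[mu]_(x in `[0%R, +oo[%classic) (expR (- e * x) * (1 + cos (w * x)))%:E)%E.
    congr (_ * _)%E; apply: eq_integral => x; rewrite inE/= in_itv/= andbT => x0.
    by rewrite /abel ger0_norm// mulNr.
  rewrite (FTC2y 0 _ _ (fun x => is_derive_abelF w x e0) (cvg_abelF w e0)).
  + congr EFin; rewrite /abelF !mulr0 expR0 cos0 sin0.
    by rewrite !mulr1 mulr0 addr0 mul1r sub0r opprD mulrN !opprK [_^-1 * e]mulrC.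
  + by move=> x; rewrite mulr_ge0 ?expR_ge0.
  + move=> x; apply: cvgM; last exact: cc.
    apply: (@continuous_comp _ _ _ (fun x : R => - e * x) expR).
      by apply: cvgM; [exact: cvg_cst|exact: cvg_id].
    exact: continuous_expR.
- by move=> x; rewrite mulr_ge0 ?abel_ge0.
- by move=> x; apply: cvgM; [exact: continuous_abel|exact: cc].
- by move=> x /=; rewrite /abel normrN mulrN cosN.
Qed.

Lemma L1_abel e : 0 < e -> L1 (abel e).
Proof.
move=> e0; have mA := continuous_measurable_fun (@continuous_abel e).
suff : L1 (fun xi => 2^-1 * (2 * abel e xi)).
  by under eq_fun do rewrite mulrA mulVf// mul1r.
apply: L1Z; apply/integrableP; split.
  by apply/measurable_EFinP; exact: measurable_funM.
have := integral_abel_1cos 0 e0.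
rewrite (_ : (\int[mu]_xi _)%E = (\int[mu]_xi `|(2 * abel e xi)%:E|)%E).
  by move=> ->; rewrite ltry.
apply: eq_integral => x _.
by rewrite /= ger0_norm ?mulr_ge0 ?abel_ge0// mul0r cos0 mulrC.
Qed.

Lemma measurable_cos_linear w : measurable_fun [set: R] (fun x => cos (w * x)).
Proof.
apply: (measurableT_comp (continuous_measurable_fun (@continuous_cos R))).
exact: measurable_funM.
Qed.

Lemma measurable_sin_linear w : measurable_fun [set: R] (fun x => sin (w * x)).
Proof.
apply: (measurableT_comp (continuous_measurable_fun (@continuous_sin R))).
exact: measurable_funM.
Qed.

Lemma L1_abel_cos e w : 0 < e -> L1 (fun xi => abel e xi * cos (w * xi)).
Proof.
move=> e0; apply: (@L1_bounded _ _ _ 1 (L1_abel e0)).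
  exact: measurable_cos_linear.
by move=> x; exact: cos_max.
Qed.

Lemma L1_abel_sin e w : 0 < e -> L1 (fun xi => abel e xi * sin (w * xi)).
Proof.
move=> e0; apply: (@L1_bounded _ _ _ 1 (L1_abel e0)).
  exact: measurable_sin_linear.
by move=> x; exact: sin_max.
Qed.

Lemma integral_abel e : 0 < e -> \int[mu]_xi abel e xi = 2 / e.
Proof.
move=> e0; have := integral_abel_1cos 0 e0 => /(congr1 fine) /=.
have -> : fine (\int[mu]_xi (abel e xi * (1 + cos (0 * xi)))%:E)%E =
    \int[mu]_xi (2 * abel e xi).
  by apply: eq_Rintegral => x _; rewrite mul0r cos0 mulrC.
rewrite RintegralZl//; last exact: L1_abel.
have -> : 2 * (e^-1 + e / (e ^+ 2 + 0 ^+ 2)) = 2 * (2 / e).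
  by field; rewrite gt_eqF.
by move/mulfI; apply.
Qed.

Lemma integral_abel_cos e w : 0 < e ->
  \int[mu]_xi (abel e xi * cos (w * xi)) = 2 * e / (e ^+ 2 + w ^+ 2).
Proof.
move=> e0; have := integral_abel_1cos w e0 => /(congr1 fine) /=.
have -> : fine (\int[mu]_xi (abel e xi * (1 + cos (w * xi)))%:E)%E =
    \int[mu]_xi (abel e xi + abel e xi * cos (w * xi)).
  by apply: eq_Rintegral => x _; rewrite mulrDr mulr1.
rewrite RintegralD//; [|exact: L1_abel|exact: L1_abel_cos].
by rewrite integral_abel// mulrDr mulrA => /addrI.
Qed.

Lemma Rintegral_odd (f : R -> R) : L1 f -> (forall x, f (- x) = - f x) ->
  \int[mu]_x f x = 0.
Proof.
move=> f1 fodd; have := Rintegral_preserving preserves_lebesgue_opp f1.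
have -> : \int[mu]_x f (- x) = - \int[mu]_x f x.
  rewrite -mulN1r -RintegralZl//.
  by apply: eq_Rintegral => x _; rewrite fodd mulN1r.
by move=> ?; lra.
Qed.

End poisson_kernel.

(** * Fourier transforms and the Plancherel inequality *)

Section cosine_sine_transforms.
Context {R : realType}.
Implicit Types (a phi : R -> R) (e x y xi : R).
Notation mu := (@lebesgue_measure R).

(** For real [a] the Fourier transform is [costf a - i * sintf a]. *)
Definition costf a xi := \int[mu]_y (a y * cos (2 * pi * y * xi)).
Definition sintf a xi := \int[mu]_y (a y * sin (2 * pi * y * xi)).
Definition poisson_conv a e x := \int[mu]_y (a y * poisson e (x - y)).

Let phase (z : R * R) : R := 2 * pi * z.1 * z.2.

Let measurable_phase : measurable_fun [set: R * R] phase.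
Proof.
by apply: measurable_funM => //; apply: measurable_funM => //; exact: measurable_fst.
Qed.

Let measurable_cos_phase : measurable_fun [set: R * R] (fun z => cos (phase z)).
Proof.
exact: (measurableT_comp (continuous_measurable_fun (@continuous_cos R))).
Qed.

Let measurable_sin_phase : measurable_fun [set: R * R] (fun z => sin (phase z)).
Proof.
exact: (measurableT_comp (continuous_measurable_fun (@continuous_sin R))).
Qed.

Let phaseC y xi : 2 * pi * y * xi = 2 * pi * xi * y :> R.
Proof. by rewrite mulrAC. Qed.

Lemma L1_mul_cos a xi : L1 a -> L1 (fun y => a y * cos (2 * pi * y * xi)).
Proof.
move=> a1; apply: (@L1_bounded _ _ _ 1 a1); last by move=> x; exact: cos_max.
by under eq_fun do rewrite phaseC; exact: measurable_cos_linear.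
Qed.

Lemma L1_mul_sin a xi : L1 a -> L1 (fun y => a y * sin (2 * pi * y * xi)).
Proof.
move=> a1; apply: (@L1_bounded _ _ _ 1 a1); last by move=> x; exact: sin_max.
by under eq_fun do rewrite phaseC; exact: measurable_sin_linear.
Qed.

Lemma measurable_costf a : L1 a -> measurable_fun [set: R] (costf a).
Proof.
move=> a1; apply: (@measurable_kernel_integral _ _ (fun z => cos (phase z))) => //.
by move=> z; exact: cos_max.
Qed.

Lemma measurable_sintf a : L1 a -> measurable_fun [set: R] (sintf a).
Proof.
move=> a1; apply: (@measurable_kernel_integral _ _ (fun z => sin (phase z))) => //.
by move=> z; exact: sin_max.
Qed.

Lemma costf_le a xi : L1 a -> `|costf a xi| <= \int[mu]_y `|a y|.
Proof.
move=> a1; apply: le_trans (le_normr_Rintegral measurableT (L1_mul_cos xi a1)) _.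
apply: le_Rintegral => //; [exact/L1_norm/L1_mul_cos|exact: L1_norm|].
by move=> y _; rewrite normrM ler_piMr// cos_max.
Qed.

Lemma sintf_le a xi : L1 a -> `|sintf a xi| <= \int[mu]_y `|a y|.
Proof.
move=> a1; apply: le_trans (le_normr_Rintegral measurableT (L1_mul_sin xi a1)) _.
apply: le_Rintegral => //; [exact/L1_norm/L1_mul_sin|exact: L1_norm|].
by move=> y _; rewrite normrM ler_piMr// sin_max.
Qed.

Lemma costfN a xi : costf a (- xi) = costf a xi.
Proof. by apply: eq_Rintegral => y _; rewrite mulrN cosN. Qed.

Lemma sintfN a xi : L1 a -> sintf a (- xi) = - sintf a xi.
Proof.
move=> a1; rewrite /sintf -[RHS]mulN1r -RintegralZl//; last exact: L1_mul_sin.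
by apply: eq_Rintegral => y _; rewrite mulrN sinN mulN1r mulrN.
Qed.

(** The multiplication formula: the kernel [cos (2 pi y xi)] is symmetric in [y] and [xi], so Fubini
    moves the transform from one factor to the other. *)
Lemma costf_pairing a phi : L1 a -> L1 phi ->
  \int[mu]_xi (phi xi * costf a xi) = \int[mu]_y (a y * costf phi y).
Proof.
move=> a1 phi1.
apply: (etrans (@Fubini_tensor _ a phi (fun z => cos (phase z)) a1 phi1
  measurable_cos_phase (fun z => cos_max (phase z)))).
apply: eq_Rintegral => y _; congr (_ * _).
by apply: eq_Rintegral => xi _; rewrite /phase/= phaseC.
Qed.

Lemma sintf_pairing a phi : L1 a -> L1 phi ->
  \int[mu]_xi (phi xi * sintf a xi) = \int[mu]_y (a y * sintf phi y).
Proof.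
move=> a1 phi1.
apply: (etrans (@Fubini_tensor _ a phi (fun z => sin (phase z)) a1 phi1
  measurable_sin_phase (fun z => sin_max (phase z)))).
apply: eq_Rintegral => y _; congr (_ * _).
by apply: eq_Rintegral => xi _; rewrite /phase/= phaseC.
Qed.

(** The product of two cosines is half the sum of the cosines of the difference and of the sum of
    the angles, and each of these integrates to a Poisson kernel. Through the multiplication
    formula, the weighted cosine integral of [costf a] becomes the even part of the Poisson integral
    of [a]; the sine version gives the odd part. *)
Lemma costf_abel_cos e x y : 0 < e ->
  costf (fun xi => abel e xi * cos (2 * pi * x * xi)) y =
  2^-1 * (poisson e (x - y) + poisson e (- x - y)).
Proof.
move=> e0; rewrite /costf -opprD poissonN /poisson -!integral_abel_cos//.
rewrite -RintegralD//; [|exact: L1_abel_cos|exact: L1_abel_cos].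
rewrite -RintegralZl//; last by apply: L1D; exact: L1_abel_cos.
apply: eq_Rintegral => xi _.
have -> : 2 * pi * (x - y) * xi = 2 * pi * x * xi - 2 * pi * xi * y :> R by ring.
have -> : 2 * pi * (x + y) * xi = 2 * pi * x * xi + 2 * pi * xi * y :> R by ring.
by rewrite cosB cosD; field.
Qed.

Lemma sintf_abel_sin e x y : 0 < e ->
  sintf (fun xi => abel e xi * sin (2 * pi * x * xi)) y =
  2^-1 * (poisson e (x - y) - poisson e (- x - y)).
Proof.
move=> e0; rewrite /sintf -opprD poissonN /poisson -!integral_abel_cos//.
rewrite -RintegralB//; [|exact: L1_abel_cos|exact: L1_abel_cos].
rewrite -RintegralZl//; last by apply: L1B; exact: L1_abel_cos.
apply: eq_Rintegral => xi _.
have -> : 2 * pi * (x - y) * xi = 2 * pi * x * xi - 2 * pi * xi * y :> R by ring.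
have -> : 2 * pi * (x + y) * xi = 2 * pi * x * xi + 2 * pi * xi * y :> R by ring.
by rewrite cosB cosD; field.
Qed.

Lemma L1_mul_poisson a e x : 0 < e -> L1 a -> L1 (fun y => a y * poisson e (x - y)).
Proof.
move=> e0 a1; apply: (@L1_bounded _ _ _ (2 / e) a1).
  exact: L1_measurable (L1_poisson_shift x e0).
by move=> y; rewrite ger0_norm ?poisson_ge0// poisson_le.
Qed.

Lemma integral_costf_abel a e x : 0 < e -> L1 a ->
  \int[mu]_xi (abel e xi * cos (2 * pi * x * xi) * costf a xi) =
  2^-1 * (poisson_conv a e x + poisson_conv a e (- x)).
Proof.
move=> e0 a1; rewrite costf_pairing//; last exact: L1_abel_cos.
rewrite /poisson_conv -RintegralD//; [|exact: L1_mul_poisson|exact: L1_mul_poisson].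
rewrite -RintegralZl//; last by apply: L1D; exact: L1_mul_poisson.
by apply: eq_Rintegral => y _; rewrite costf_abel_cos//; ring.
Qed.

Lemma integral_sintf_abel a e x : 0 < e -> L1 a ->
  \int[mu]_xi (abel e xi * sin (2 * pi * x * xi) * sintf a xi) =
  2^-1 * (poisson_conv a e x - poisson_conv a e (- x)).
Proof.
move=> e0 a1; rewrite sintf_pairing//; last exact: L1_abel_sin.
rewrite /poisson_conv -RintegralB//; [|exact: L1_mul_poisson|exact: L1_mul_poisson].
rewrite -RintegralZl//; last by apply: L1B; exact: L1_mul_poisson.
by apply: eq_Rintegral => y _; rewrite sintf_abel_sin//; ring.
Qed.

Lemma measurable_poisson_conv a e : 0 < e -> L1 a ->
  measurable_fun [set: R] (poisson_conv a e).
Proof.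
move=> e0 a1.
have mP := continuous_measurable_fun (continuous_poisson e0).
(* The factor [e / 2] brings the kernel, which is at most [2 / e], below 1. *)
have mk : measurable_fun [set: R * R] (fun z => 2^-1 * e * poisson e (z.2 - z.1)).
  apply: measurable_funM => //; apply: (measurableT_comp mP).
  by apply: measurable_funB; [exact: measurable_snd|exact: measurable_fst].
have := measurable_kernel_integral a1 mk; rewrite /=.
have -> : poisson_conv a e =
    (fun x => 2 / e * \int[mu]_y (a y * (2^-1 * e * poisson e (x - y)))).
  apply/funext => x; rewrite -RintegralZl//; last first.
    have -> : (fun y => a y * (2^-1 * e * poisson e (x - y))) =
        (fun y => 2^-1 * e * (a y * poisson e (x - y))).
      by apply/funext => y; ring.
    exact/L1Z/L1_mul_poisson.
  by apply: eq_Rintegral => y _; field; rewrite gt_eqF.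
move=> H; apply: measurable_funM => //; apply: H => z.
have e2 : 0 <= 2^-1 * e by rewrite mulr_ge0// ltW.
rewrite (ger0_norm (mulr_ge0 e2 (poisson_ge0 _ e0))).
apply: (@le_trans _ _ (2^-1 * e * (2 / e))).
  by rewrite ler_wpM2l ?poisson_le.
by rewrite (_ : 2^-1 * e * (2 / e) = 1)//; field; rewrite gt_eqF.
Qed.

Lemma integral_poisson_conv a e : 0 < e -> L1 a -> (forall x, 0 <= a x) ->
  (\int[mu]_x (poisson_conv a e x)%:E = (\int[mu]_x a x)%:E)%E.
Proof.
move=> e0 a1 a0.
have ma := L1_measurable a1.
have mP := continuous_measurable_fun (continuous_poisson e0).
have mk : measurable_fun [set: R * R] (fun z => (a z.2 * poisson e (z.1 - z.2))%:E).
  apply/measurable_EFinP; apply: measurable_funM.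
    exact: measurableT_comp ma measurable_snd.
  apply: (measurableT_comp mP).
  by apply: measurable_funB; [exact: measurable_fst|exact: measurable_snd].
transitivity (\int[mu]_x \int[mu]_y (a y * poisson e (x - y))%:E)%E.
  apply: eq_integral => x _; rewrite fineK//.
  exact: integrable_fin_num (L1_mul_poisson x e0 a1).
have -> := @fubini_tonelli _ _ _ _ _ mu mu _ mk; last first.
  by move=> z; rewrite lee_fin mulr_ge0 ?poisson_ge0.
rewrite fineK; last exact: integrable_fin_num a1.
apply: eq_integral => y _.
transitivity (\int[mu]_x ((a y)%:E * (poisson e (x - y))%:E))%E.
  by apply: eq_integral.
rewrite ge0_integralZl//.
- rewrite (_ : (\int[mu]_x _)%E = 1%E) ?mule1//.
  rewrite -(integral_poisson_shift y e0); apply: eq_integral => x _.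
  by rewrite -poissonN opprB.
- apply/measurable_EFinP; apply: (measurableT_comp mP).
  exact: measurable_funB.
- by move=> x _; rewrite lee_fin poisson_ge0.
- by rewrite lee_fin.
Qed.

Lemma L1_poisson_conv a e : 0 < e -> L1 a -> (forall x, 0 <= a x) ->
  L1 (poisson_conv a e).
Proof.
move=> e0 a1 a0; apply/integrableP; split.
  by apply/measurable_EFinP; exact: measurable_poisson_conv.
rewrite (_ : (\int[mu]_x _)%E = (\int[mu]_x (poisson_conv a e x)%:E)%E).
  by rewrite integral_poisson_conv// ltry.
apply: eq_integral => x _; rewrite /= ger0_norm//.
by apply: Rintegral_ge0 => y _; rewrite mulr_ge0 ?poisson_ge0.
Qed.

End cosine_sine_transforms.

(** * The Plancherel inequality by Abel summation *)

Section plancherel_inequality.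
Context {R : realType}.
Implicit Types (a b : R -> R) (e x y xi : R).
Notation mu := (@lebesgue_measure R).

Let L1_abel_bounded e (h : R -> R) (M : R) : 0 < e -> measurable_fun [set: R] h ->
  (forall x, `|h x| <= M) -> L1 (fun xi => abel e xi * h xi).
Proof. by move=> e0 mh hM; exact: L1_bounded (L1_abel e0) mh hM. Qed.

Lemma L1_costf2 a e : 0 < e -> L1 a -> L1 (fun xi => abel e xi * costf a xi ^+ 2).
Proof.
move=> e0 a1; apply: (@L1_abel_bounded _ _ ((\int[mu]_y `|a y|) ^+ 2)) => //.
  by apply: measurable_funX; exact: measurable_costf.
move=> xi; rewrite normrX ler_pXn2r ?nnegrE ?Rintegral_ge0//.
exact: costf_le.
Qed.

Lemma L1_sintf2 a e : 0 < e -> L1 a -> L1 (fun xi => abel e xi * sintf a xi ^+ 2).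
Proof.
move=> e0 a1; apply: (@L1_abel_bounded _ _ ((\int[mu]_y `|a y|) ^+ 2)) => //.
  by apply: measurable_funX; exact: measurable_sintf.
move=> xi; rewrite normrX ler_pXn2r ?nnegrE ?Rintegral_ge0//.
exact: sintf_le.
Qed.

Let poisson_conv_le a e x : 0 < e -> L1 a ->
  `|poisson_conv a e x| <= 2 / e * \int[mu]_y `|a y|.
Proof.
move=> e0 a1.
apply: le_trans (le_normr_Rintegral measurableT (L1_mul_poisson x e0 a1)) _.
rewrite -RintegralZl//; last exact: L1_norm.
apply: le_Rintegral => //; [exact/L1_norm/L1_mul_poisson|exact/L1Z/L1_norm|].
by move=> y _; rewrite normrM mulrC ler_wpM2r// ger0_norm ?poisson_ge0// poisson_le.
Qed.

Let L1_mul_conv a e : 0 < e -> L1 a -> L1 (fun y => a y * poisson_conv a e y).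
Proof.
move=> e0 a1; apply: (@L1_bounded _ _ _ (2 / e * \int[mu]_y `|a y|) a1).
  exact: measurable_poisson_conv.
by move=> x; exact: poisson_conv_le.
Qed.

Let L1_mul_convN a e : 0 < e -> L1 a -> L1 (fun y => a y * poisson_conv a e (- y)).
Proof.
move=> e0 a1; apply: (@L1_bounded _ _ _ (2 / e * \int[mu]_y `|a y|) a1).
  apply: (measurableT_comp (measurable_poisson_conv e0 a1)).
  exact: oppr_measurable.
by move=> x; exact: poisson_conv_le.
Qed.

(** In each square, one factor is moved onto [a] by the multiplication formula. The cosine part then
    produces the even half of the Poisson integral and the sine part the odd half; in their sum the
    reflected values [poisson_conv a e (- y)] cancel. *)
Lemma abel_plancherel a e : 0 < e -> L1 a ->
  \int[mu]_xi (abel e xi * (costf a xi ^+ 2 + sintf a xi ^+ 2)) =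
  \int[mu]_y (a y * poisson_conv a e y).
Proof.
move=> e0 a1.
have LC : L1 (fun xi => abel e xi * costf a xi).
  apply: (@L1_abel_bounded _ _ (\int[mu]_y `|a y|)) => //; first exact: measurable_costf.
  by move=> xi; exact: costf_le.
have LS : L1 (fun xi => abel e xi * sintf a xi).
  apply: (@L1_abel_bounded _ _ (\int[mu]_y `|a y|)) => //; first exact: measurable_sintf.
  by move=> xi; exact: sintf_le.
transitivity (\int[mu]_xi (abel e xi * costf a xi * costf a xi) +
              \int[mu]_xi (abel e xi * sintf a xi * sintf a xi)).
  have -> : \int[mu]_xi (abel e xi * (costf a xi ^+ 2 + sintf a xi ^+ 2)) =
      \int[mu]_xi (abel e xi * costf a xi ^+ 2 + abel e xi * sintf a xi ^+ 2).
    by apply: eq_Rintegral => xi _; rewrite mulrDr.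
  rewrite RintegralD//; [|exact: L1_costf2|exact: L1_sintf2].
  by congr (_ + _); apply: eq_Rintegral => xi _; rewrite -mulrA -expr2.
rewrite costf_pairing// sintf_pairing//.
have -> : \int[mu]_y (a y * costf (fun xi => abel e xi * costf a xi) y) =
   \int[mu]_y (2^-1 * (a y * poisson_conv a e y + a y * poisson_conv a e (- y))).
  apply: eq_Rintegral => y _; rewrite -mulrDr mulrCA -integral_costf_abel//.
  by congr (_ * _); apply: eq_Rintegral => xi _; rewrite [2 * pi * xi * y]mulrAC; ring.
have -> : \int[mu]_y (a y * sintf (fun xi => abel e xi * sintf a xi) y) =
   \int[mu]_y (2^-1 * (a y * poisson_conv a e y - a y * poisson_conv a e (- y))).
  apply: eq_Rintegral => y _; rewrite -mulrBr mulrCA -integral_sintf_abel//.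
  by congr (_ * _); apply: eq_Rintegral => xi _; rewrite [2 * pi * xi * y]mulrAC; ring.
rewrite -RintegralD//; last 2 first.
- by apply: L1Z; apply: L1D; [exact: L1_mul_conv|exact: L1_mul_convN].
- by apply: L1Z; apply: L1B; [exact: L1_mul_conv|exact: L1_mul_convN].
by apply: eq_Rintegral => y _; field.
Qed.

(** Under the double integral, [a y * a z] is at most the mean of [a y ^+ 2] and [a z ^+ 2], and the
    kernel has mass 1 in either variable. *)
Lemma integral_mul_poisson_conv_le a e : 0 < e -> L1 a -> L2 a ->
  \int[mu]_y (a y * poisson_conv a e y) <= \int[mu]_y (a y ^+ 2).
Proof.
move=> e0 a1 [ma a2].
have L1c : L1 (poisson_conv (fun y => a y ^+ 2) e).
  by apply: L1_poisson_conv => // x; exact: sqr_ge0.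
apply: (@le_trans _ _
  (\int[mu]_y (2^-1 * (a y ^+ 2 + poisson_conv (fun y => a y ^+ 2) e y)))).
  apply: le_Rintegral => //; [exact: L1_mul_conv|by apply: L1Z; exact: L1D|].
  move=> y _; rewrite -RintegralZl//; last exact: L1_mul_poisson.
  have -> : a y ^+ 2 = \int[mu]_z (a y ^+ 2 * poisson e (y - z)).
    rewrite RintegralZl//; last exact: L1_poisson_shift.
    by rewrite /Rintegral integral_poisson_shift// mulr1.
  rewrite -RintegralD//; last 2 first.
  - exact/L1Z/L1_poisson_shift.
  - exact: L1_mul_poisson.
  rewrite -RintegralZl//; last first.
    by apply: L1D; [exact/L1Z/L1_poisson_shift|exact: L1_mul_poisson].
  apply: le_Rintegral => //.
  - exact/L1Z/L1_mul_poisson.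
  - by apply: L1Z; apply: L1D; [exact/L1Z/L1_poisson_shift|exact: L1_mul_poisson].
  move=> z _; rewrite mulrA -mulrDl mulrA ler_wpM2r ?poisson_ge0//.
  by have := sqr_ge0 (a y - a z); lra.
rewrite RintegralZl ?RintegralD//; last exact: L1D.
rewrite {2}/Rintegral integral_poisson_conv//=; last by move=> x; exact: sqr_ge0.
by rewrite -mulr2n -[X in _ * X]mulr_natl mulrA mulVf// mul1r.
Qed.

Lemma plancherel_le a : L1 a -> L2 a ->
  (\int[mu]_xi (costf a xi ^+ 2 + sintf a xi ^+ 2)%:E <= (\int[mu]_y (a y ^+ 2))%:E)%E.
Proof.
move=> a1 a2; set N := fun xi => costf a xi ^+ 2 + sintf a xi ^+ 2.
have N0 xi : 0 <= N xi by rewrite addr_ge0 ?sqr_ge0.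
have mN : measurable_fun [set: R] N.
  apply: measurable_funD; apply: measurable_funX.
    exact: measurable_costf.
  exact: measurable_sintf.
pose g (n : nat) xi : \bar R := (abel n.+1%:R^-1 xi * N xi)%:E.
have mg n : measurable_fun [set: R] (g n).
  apply/measurable_EFinP; apply: measurable_funM => //.
  exact: continuous_measurable_fun (@continuous_abel R _).
have g0 n xi : [set: R] xi -> (0 <= g n xi)%E.
  by move=> _; rewrite lee_fin mulr_ge0 ?abel_ge0.
have ndg xi : [set: R] xi -> {homo g^~ xi : n m / (n <= m)%N >-> (n <= m)%E}.
  move=> _ n m nm; rewrite lee_fin ler_wpM2r// ler_expR lerN2 ler_wpM2r//.
  by rewrite lef_pV2 ?posrE// ler_nat.
have gN xi : g n xi @[n --> \oo] --> (N xi)%:E.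
  apply: cvg_EFin; first exact: nearW.
  rewrite -[X in _ --> X]mul1r; apply: cvgM; last exact: cvg_cst.
  have H : - (n.+1%:R^-1 * `|xi|) @[n --> \oo] --> (0 : R).
    rewrite -[X in _ --> X]oppr0 -[X in _ --> - X](mul0r `|xi|).
    by apply: cvgN; apply: cvgM; [exact: (@cvg_harmonic R)|exact: cvg_cst].
  rewrite -[X in _ --> X]expR0; apply: (cvg_comp _ _ H).
  exact: continuous_expR.
have -> : (\int[mu]_xi (N xi)%:E)%E = (\int[mu]_xi limn (g^~ xi))%E.
  by apply: eq_integral => xi _; apply/esym/cvg_lim.
rewrite monotone_convergence//; apply: lime_le.
  apply: ereal_nondecreasing_is_cvgn => n m nm.
  apply: ge0_le_integral => [||||xi xiT]; [exact: measurableT|exact: (g0 n)|exact: mg|exact: mg|].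
  exact: (ndg xi xiT).
apply: nearW => n.
have e0 : 0 < n.+1%:R^-1 :> R by rewrite invr_gt0.
have Lg : L1 (fun xi => abel n.+1%:R^-1 xi * N xi).
  have := L1D (L1_costf2 e0 a1) (L1_sintf2 e0 a1).
  by under eq_fun do rewrite -mulrDr.
rewrite -[X in (X <= _)%E]fineK; last exact: integrable_fin_num Lg.
rewrite lee_fin.
have := integral_mul_poisson_conv_le e0 a1 a2.
by rewrite -abel_plancherel.
Qed.

Lemma L2_costf_sintf a : L1 a -> L2 a ->
  [/\ L2 (costf a), L2 (sintf a) &
   \int[mu]_xi (costf a xi ^+ 2) + \int[mu]_xi (sintf a xi ^+ 2)
   <= \int[mu]_y (a y ^+ 2)].
Proof.
move=> a1 a2; have P := plancherel_le a1 a2.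
have mc := measurable_costf a1; have ms := measurable_sintf a1.
have L : L1 (fun xi => costf a xi ^+ 2 + sintf a xi ^+ 2).
  apply/integrableP; split.
    by apply/measurable_EFinP; apply: measurable_funD; exact: measurable_funX.
  rewrite (_ : (\int[mu]_x _)%E = (\int[mu]_xi (costf a xi ^+ 2 + sintf a xi ^+ 2)%:E)%E).
    by rewrite (le_lt_trans P)// ltry.
  by apply: eq_integral => xi _; rewrite /= ger0_norm// addr_ge0 ?sqr_ge0.
have Lc : L1 (fun xi => costf a xi ^+ 2).
  apply: L1_le L _; first exact: measurable_funX.
  by move=> xi; rewrite ger0_norm ?sqr_ge0// lerDl sqr_ge0.
have Ls : L1 (fun xi => sintf a xi ^+ 2).
  apply: L1_le L _; first exact: measurable_funX.
  by move=> xi; rewrite ger0_norm ?sqr_ge0// lerDr sqr_ge0.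
split=> //; rewrite -RintegralD// -lee_fin fineK//.
exact: integrable_fin_num L.
Qed.

(* The cross terms in [|a^ + i b^|^2] are odd, hence integrate to [0]. *)
Lemma complex_plancherel_le a b : L1 a -> L2 a -> L1 b -> L2 b ->
  [/\ L2 (fun xi => costf a xi + sintf b xi),
      L2 (fun xi => costf b xi - sintf a xi) &
   \int[mu]_xi ((costf a xi + sintf b xi) ^+ 2) +
   \int[mu]_xi ((costf b xi - sintf a xi) ^+ 2)
   <= \int[mu]_y (a y ^+ 2) + \int[mu]_y (b y ^+ 2)].
Proof.
move=> a1 a2 b1 b2.
have [ca sa Pa] := L2_costf_sintf a1 a2; have [cb sb Pb] := L2_costf_sintf b1 b2.
have L2re : L2 (fun xi => costf a xi + sintf b xi) by exact: L2D.
have L2im : L2 (fun xi => costf b xi - sintf a xi) by exact: L2B.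
split=> //.
have cross c d : L1 c -> L1 d -> L2 (costf c) -> L2 (sintf d) ->
    \int[mu]_xi (costf c xi * sintf d xi) = 0.
  move=> c1 d1 cc sd; apply: Rintegral_odd; first exact: L2M.
  by move=> xi; rewrite costfN sintfN// mulrN.
have := cross a b a1 b1 ca sb; have := cross b a b1 a1 cb sa.
move: (L2M ca sb) (L2M cb sa) (ca.2) (sa.2) (cb.2) (sb.2) => Lab Lba ca' sa' cb' sb' E1 E2.
have -> : \int[mu]_xi ((costf a xi + sintf b xi) ^+ 2) =
   \int[mu]_xi (costf a xi ^+ 2) + \int[mu]_xi (sintf b xi ^+ 2).
  transitivity (\int[mu]_xi ((costf a xi ^+ 2 + sintf b xi ^+ 2) + 2 * (costf a xi * sintf b xi))).
    by apply: eq_Rintegral => xi _; ring.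
  rewrite RintegralD//; [|exact: L1D|exact: L1Z].
  by rewrite RintegralD// RintegralZl// E2 mulr0 addr0.
have -> : \int[mu]_xi ((costf b xi - sintf a xi) ^+ 2) =
   \int[mu]_xi (costf b xi ^+ 2) + \int[mu]_xi (sintf a xi ^+ 2).
  transitivity (\int[mu]_xi ((costf b xi ^+ 2 + sintf a xi ^+ 2) + - 2 * (costf b xi * sintf a xi))).
    by apply: eq_Rintegral => xi _; ring.
  rewrite RintegralD//; [|exact: L1D|exact: L1Z].
  by rewrite RintegralD// RintegralZl// E1 mulr0 addr0.
rewrite [X in _ + X <= _]addrC addrACA [X in _ + X <= _]addrC.
exact: lerD.
Qed.

End plancherel_inequality.

(** * Poisson integrals at Lebesgue points *)

Section poisson_lebesgue_points.
Context {R : realType}.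
Implicit Types (f h : R -> R) (e x y delta rho : R).
Notation mu := (@lebesgue_measure R).

(** From [pi >= 2], the term [(2 * pi * t) ^+ 2] of the denominator is at least [16 * rho ^+ 2]. *)
Lemma poisson_tail e t rho : 0 < e -> 0 < rho -> rho <= `|t| ->
  poisson e t <= e / (8 * rho ^+ 2).
Proof.
move=> e0 rho0 rt; rewrite /poisson ler_pdivrMr ?poisson_denom_gt0//.
have -> : e / (8 * rho ^+ 2) * (e ^+ 2 + (2 * pi * t) ^+ 2) =
    e ^+ 3 / (8 * rho ^+ 2) + e * (pi ^+ 2 * (t ^+ 2 / rho ^+ 2)) / 2.
  by move: (@pi R) => p; field; rewrite gt_eqF.
have r1 : 1 <= t ^+ 2 / rho ^+ 2.
  rewrite ler_pdivlMr ?exprn_gt0// mul1r -[t ^+ 2]real_normK ?num_real//.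
  by rewrite ler_pXn2r// nnegrE// ltW.
have p4 : 4 <= pi ^+ 2 :> R.
  have -> : 4 = 2 ^+ 2 :> R by ring.
  by rewrite ler_pXn2r// ?nnegrE ?pi_ge2// pi_ge0.
have H : 4 <= pi ^+ 2 * (t ^+ 2 / rho ^+ 2).
  by rewrite -[4]mulr1; apply: ler_pM.
have e3 : 0 <= e ^+ 3 / (8 * rho ^+ 2).
  by rewrite divr_ge0 ?mulr_ge0 ?exprn_ge0// ltW.
have : e * 4 <= e * (pi ^+ 2 * (t ^+ 2 / rho ^+ 2)) by rewrite ler_wpM2l// ltW.
by lra.
Qed.

(** Away from its centre the kernel is [e] times a multiple, fixed by [rho], of [poisson 1]. Hence
    the far part of a Poisson integral tends to 0 with [e] as soon as the function is integrable
    against [poisson 1]; this covers [|f - f x|], which contains a constant and need not be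
    integrable itself. *)
Lemma poisson_far e t rho : 0 < e -> 0 < rho -> rho <= `|t| ->
  poisson e t <= e * (1 + (2 * pi * rho) ^- 2) * poisson 1 t.
Proof.
move=> e0 rho0 rt; have pi0 := @pi_gt0 R.
have s0 : 0 < (2 * pi * rho) ^+ 2 by rewrite exprn_gt0// !mulr_gt0.
have ss : (2 * pi * rho) ^+ 2 <= (2 * pi * t) ^+ 2.
  rewrite -[leRHS]real_normK ?num_real// ler_pXn2r ?nnegrE ?mulr_ge0 ?(ltW rho0) ?(ltW pi0)//.
  by rewrite normrM gtr0_norm ?mulr_gt0// ler_wpM2l// ltW// mulr_gt0.
rewrite /poisson expr1n mulr1; set s := (2 * pi * t) ^+ 2 in ss *.
set r := (2 * pi * rho) ^+ 2 in ss s0 *.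
have s0' : 0 < s by exact: lt_le_trans ss.
have s1 : 0 < 1 + s by lra.
apply: (@le_trans _ _ (2 * e / s)).
  by rewrite ler_wpM2l ?mulr_ge0 ?(ltW e0)// lef_pV2 ?posrE// ?ler_wpDl ?sqr_ge0// ltr_wpDl ?sqr_ge0.
have -> : e * (1 + r^-1) * (2 / (1 + s)) = 2 * e * ((1 + r^-1) / (1 + s)) by ring.
rewrite ler_wpM2l ?mulr_ge0 ?(ltW e0)//.
rewrite ler_pdivlMr// ler_pdivrMl//.
have -> : s * (1 + r^-1) = s + s / r by ring.
have : 1 <= s / r by rewrite ler_pdivlMr// mul1r.
by lra.
Qed.

(** * Poisson averages of a nonnegative function with small mean over small balls *)

Section average.
Variables (h : R -> R) (x delta r0 : R).
Hypotheses (mh : measurable_fun [set: R] h) (h0 : forall y, 0 <= h y).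
Hypothesis hP : L1 (fun y => h y * poisson 1 (x - y)).
Hypotheses (delta0 : 0 < delta) (r0_gt0 : 0 < r0).
Hypothesis h_avg : forall r, 0 < r -> r < r0 ->
  (\int[mu]_(y in ball x r) (h y)%:E <= (2 * r * delta)%:E)%E.

Let mhP e : 0 < e -> measurable_fun [set: R] (fun y => (h y * poisson e (x - y))%:E).
Proof.
move=> e0; apply/measurable_EFinP; apply: measurable_funM => //.
exact: L1_measurable (L1_poisson_shift x e0).
Qed.

Let hP0 e y : 0 < e -> (0 <= (h y * poisson e (x - y))%:E)%E.
Proof. by move=> e0; rewrite lee_fin mulr_ge0 ?poisson_ge0. Qed.

(* Dyadic annuli: on [2^m e <= |t| < 2^(m+1) e] the kernel is at most
   [1 / (8 * 4^m e)] whereas the mass of [h] is at most [4 * 2^m e * delta]. *)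
Lemma poisson_near_average e m : 0 < e -> 2 ^+ m * e < r0 ->
  (\int[mu]_(y in ball x (2 ^+ m * e)) (h y * poisson e (x - y))%:E
     <= (delta * (5 - 2^-1 ^+ m))%:E)%E.
Proof.
(* The central ball costs at most [4 * delta], and passing from [m] to [m + 1] adds
   [delta * 2^-1 ^+ m.+1]; the partial sums are [delta * (5 - 2^-1 ^+ m)]. *)
move=> e0; elim: m => [|m IH] mr.
  rewrite expr0 mul1r in mr *.
  apply: (@le_trans _ _ (\int[mu]_(y in ball x e) ((2 / e)%:E * (h y)%:E))%E).
    apply: ge0_le_integral => //.
    - exact: measurable_ball.
    - by move=> y _; exact: hP0.
    - by apply: measurable_funTS; exact: mhP.
    - by apply/measurable_EFinP; apply: measurable_funTS; exact: measurable_funM.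
    - by move=> y _; rewrite -EFinM lee_fin mulrC ler_wpM2r ?poisson_le.
  rewrite ge0_integralZl//; last 4 first.
  - exact: measurable_ball.
  - by apply/measurable_EFinP; exact: measurable_funTS.
  - by move=> y _; rewrite lee_fin.
  - by rewrite lee_fin divr_ge0 ?ltW.
  apply: (@le_trans _ _ ((2 / e)%:E * (2 * e * delta)%:E)%E).
    by rewrite lee_wpmul2l ?lee_fin ?divr_ge0 ?(ltW e0)//; exact: h_avg.
  rewrite -EFinM lee_fin.
  have -> : 2 / e * (2 * e * delta) = delta * 4 by field; rewrite gt_eqF.
  by rewrite ler_wpM2l ?(ltW delta0)// expr0; lra.
have twoe : 2 ^+ m.+1 * e = 2 * (2 ^+ m * e) by rewrite exprS mulrA.
have pe : 0 < 2 ^+ m * e by rewrite mulr_gt0 ?exprn_gt0.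
have sub : ball x (2 ^+ m * e) `<=` ball x (2 ^+ m.+1 * e).
  by apply: le_ball; rewrite twoe; lra.
have IH' : 2 ^+ m * e < r0 by lra.
rewrite -(setDUK sub) ge0_integral_setU//; last 5 first.
- exact: measurable_ball.
- by apply: measurableD; exact: measurable_ball.
- by apply: measurable_funTS; exact: mhP.
- by move=> y _; exact: hP0.
- by rewrite disj_set2E setDIK.
have -> : delta * (5 - 2^-1 ^+ m.+1) =
    delta * (5 - 2^-1 ^+ m) + delta * 2^-1 ^+ m.+1.
  by rewrite exprS; move: (_ ^+ m) => z; field.
rewrite EFinD leeD ?IH//.
pose c := e / (8 * (2 ^+ m * e) ^+ 2).
have c0 : 0 <= c by rewrite divr_ge0 ?mulr_ge0 ?sqr_ge0 ?ltW.
apply: (@le_trans _ _ (\int[mu]_(y in ball x (2 ^+ m.+1 * e) `\` ball x (2 ^+ m * e))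
    (c%:E * (h y)%:E))%E).
  apply: ge0_le_integral => //.
  - by apply: measurableD; exact: measurable_ball.
  - by move=> y _; exact: hP0.
  - by apply: measurable_funTS; exact: mhP.
  - by apply/measurable_EFinP; apply: measurable_funTS; exact: measurable_funM.
  - move=> y [_ nb]; rewrite -EFinM lee_fin mulrC ler_wpM2r//.
    apply: poisson_tail => //; rewrite leNgt; apply/negP => yb; apply: nb.
    by rewrite /ball/=.
apply: (@le_trans _ _ (\int[mu]_(y in ball x (2 ^+ m.+1 * e)) (c%:E * (h y)%:E))%E).
  apply: ge0_subset_integral => //.
  - by apply: measurableD; exact: measurable_ball.
  - exact: measurable_ball.
  - by apply/measurable_EFinP; apply: measurable_funTS; exact: measurable_funM.
  - by move=> y _; rewrite -EFinM lee_fin mulr_ge0.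
rewrite ge0_integralZl//; last 3 first.
- exact: measurable_ball.
- by apply/measurable_EFinP; exact: measurable_funTS.
- by move=> y _; rewrite lee_fin.
apply: (@le_trans _ _ (c%:E * (2 * (2 ^+ m.+1 * e) * delta)%:E)%E).
  by rewrite lee_wpmul2l ?lee_fin//; apply: h_avg; rewrite ?twoe; lra.
rewrite -EFinM lee_fin le_eqVlt; apply/orP; left; apply/eqP.
rewrite /c exprVn ![2 ^+ m.+1]exprS.
have : 0 < 2 ^+ m :> R by rewrite exprn_gt0.
by move: (2 ^+ m) => p p0; field; rewrite !gt_eqF.
Qed.

(** The integral is split at a fixed radius [rho = 2^-1 ^+ j] below [r0]. The inner part is at most
    [5 * delta] by the dyadic bound with [k - j] annuli, which end exactly at [rho] because the
    parameter is itself a power of [1 / 2]. The outer part is at most [2^-1 ^+ k * K], hence below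
    [delta] for large [k]. *)
Lemma poisson_average : exists N : nat, forall k, (N <= k)%N ->
  (\int[mu]_y (h y * poisson (2^-1 ^+ k) (x - y))%:E <= (6 * delta)%:E)%E.
Proof.
have half : (2^-1 ^+ k : R) @[k --> \oo] --> (0 : R).
  by apply: cvg_expr; rewrite gtr0_norm// invf_lt1// ltr1n.
have ek k : 0 < 2^-1 ^+ k :> R by rewrite exprn_gt0// invr_gt0.
have [j _ jr] : \forall j \near \oo, 2^-1 ^+ j < r0 :> R.
  by move/cvgrPdist_lt: half => /(_ _ r0_gt0); apply: filterS => j;
     rewrite sub0r normrN gtr0_norm.
have {}jr := jr j (leqnn j).
set rho := 2^-1 ^+ j in jr; have rho0 : 0 < rho by exact: ek.
set I := \int[mu]_y (h y * poisson 1 (x - y)).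
pose K := (1 + (2 * pi * rho) ^- 2) * I.
have I0 : 0 <= I by apply: Rintegral_ge0 => y _; rewrite mulr_ge0 ?poisson_ge0.
have [N _ NK] : \forall k \near \oo, 2^-1 ^+ k * K < delta.
  have : (2^-1 ^+ k * K : R) @[k --> \oo] --> (0 : R).
    by rewrite -[X in _ --> X](mul0r K); apply: cvgM => //; exact: cvg_cst.
  move/cvgrPdist_lt => /(_ _ delta0); apply: filterS => k.
  by rewrite sub0r normrN; apply: le_lt_trans; exact: ler_norm.
exists (maxn j N) => k; rewrite geq_max => /andP[jk Nk].
have {NK} Kd := NK k Nk; have e0 := ek k; set e := 2^-1 ^+ k in Kd e0 *.
have er : 2 ^+ (k - j) * e = rho.
  by rewrite /e -(subnK jk) exprD mulrA addnK -exprMn divff// expr1n mul1r.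
have := @poisson_near_average e (k - j) e0; rewrite er => /(_ jr) near.
have mb : measurable (ball x rho) by exact: measurable_ball.
rewrite -(setUv (ball x rho)) ge0_integral_setU//; last 4 first.
- exact: measurableC.
- by rewrite setUv; exact: mhP.
- by move=> y _; exact: hP0.
- exact/disj_setPCl.
have -> : 6 * delta = delta * 5 + delta by ring.
rewrite EFinD leeD//.
  apply: (le_trans near); rewrite lee_fin ler_wpM2l ?(ltW delta0)//.
  by rewrite gerBl exprn_ge0.
set c := e * (1 + (2 * pi * rho) ^- 2).
have c0 : 0 <= c by rewrite mulr_ge0 ?(ltW e0)// addr_ge0// invr_ge0 sqr_ge0.
apply: (@le_trans _ _ (\int[mu]_y (c%:E * (h y * poisson 1 (x - y))%:E))%E).
  apply: (@le_trans _ _ (\int[mu]_(y in ~` ball x rho) (c%:E * (h y * poisson 1 (x - y))%:E))%E).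
    apply: ge0_le_integral => //.
    - exact: measurableC.
    - by move=> y _; exact: hP0.
    - by apply: measurable_funTS; exact: mhP.
    - by apply: measurable_funeM; apply: measurable_funTS; exact: mhP.
    - move=> y nb; rewrite -EFinM lee_fin [leRHS]mulrCA ler_wpM2l//.
      apply: poisson_far => //; rewrite leNgt; apply/negP => yb; apply: nb.
      by rewrite /ball/=.
  apply: ge0_subset_integral => //.
  - exact: measurableC.
  - by apply: measurable_funeM; exact: mhP.
  - by move=> y _; apply: mule_ge0; [rewrite lee_fin|exact: hP0].
rewrite integralZl//.
have -> : (\int[mu]_y (h y * poisson 1 (x - y))%:E)%E = I%:E.
  by rewrite fineK//; exact: integrable_fin_num hP.
by rewrite -EFinM lee_fin ltW// /c -[X in X < _]mulrA.
Qed.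

End average.

Lemma lebesgue_pt_average f x : lebesgue_pt f x -> forall delta, 0 < delta ->
  exists2 r0, 0 < r0 & forall r, 0 < r -> r < r0 ->
    (\int[mu]_(y in ball x r) (`|f y - f x|)%:E <= (2 * r * delta)%:E)%E.
Proof.
move=> fx delta delta0.
have /fx : nbhs (0%E : \bar R) [set z | (z < delta%:E)%E].
  by apply: open_nbhs_nbhs; split; [exact: open_ereal_lt_ereal|rewrite /= lte_fin].
rewrite /= => -[r0 /= r0_gt0 H]; exists r0 => // r rpos rr0.
have : (davg f x r < delta%:E)%E.
  by apply: H => //=; rewrite sub0r normrN gtr0_norm.
rewrite /davg /iavg (lebesgue_measure_ball x (ltW rpos)).
have r2 : 0 < r *+ 2 by rewrite pmulrn_lgt0.
rewrite inver gt_eqF// => /ltW.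
rewrite -(@lee_pmul2l _ (r *+ 2)%:E)//.
rewrite muleA -EFinM divff ?gt_eqF// mul1e.
move/le_trans; apply.
by rewrite -EFinM lee_fin -[r *+ 2]mulr_natl.
Qed.

(** As the kernel has mass 1, [f x] is the Poisson average of a constant, and the error is at most
    the Poisson average of [|f - f x|], whose means over small balls are small. *)
Lemma poisson_conv_lebesgue_pt f x : L2 f -> lebesgue_pt f x ->
  poisson_conv f (2^-1 ^+ k) x @[k --> \oo] --> f x.
Proof.
move=> f2 fx; apply/cvgrPdist_le => eps eps0.
pose h y := `|f y - f x|.
have mh : measurable_fun [set: R] h.
  by apply: measurableT_comp => //; apply: measurable_funB => //; exact: f2.1.
have hPe e : 0 < e -> L1 (fun y => h y * poisson e (x - y)).
  move=> e0.
  have : L1 (fun y => `|f y * poisson e (x - y) - f x * poisson e (x - y)|).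
    apply/L1_norm/L1B; first by apply: L2M => //; exact: L2_poisson_shift.
    exact/L1Z/L1_poisson_shift.
  congr L1; apply/funext => y.
  by rewrite -mulrBl normrM [X in _ * X]ger0_norm ?poisson_ge0.
(* Compensates the factor 6 in [poisson_average]. *)
have d0 : 0 < eps / 6 by rewrite divr_gt0.
have [r0 r0_gt0 avg] := lebesgue_pt_average fx d0.
have [N NP] := @poisson_average h x (eps / 6) r0 mh (fun y => normr_ge0 _) (hPe _ ltr01) d0 r0_gt0 avg.
exists N => // k /= Nk; have e0 : 0 < 2^-1 ^+ k :> R by rewrite exprn_gt0// invr_gt0.
have Lf : L1 (fun y => f y * poisson (2^-1 ^+ k) (x - y)).
  by apply: L2M => //; exact: L2_poisson_shift.
have -> : f x = \int[mu]_y (f x * poisson (2^-1 ^+ k) (x - y)).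
  rewrite RintegralZl//; last exact: L1_poisson_shift.
  by rewrite /Rintegral integral_poisson_shift// mulr1.
rewrite distrC -RintegralB//; last exact/L1Z/L1_poisson_shift.
apply: (@le_trans _ _ (\int[mu]_y (h y * poisson (2^-1 ^+ k) (x - y)))).
  have LB : L1 (fun y => f y * poisson (2^-1 ^+ k) (x - y) - f x * poisson (2^-1 ^+ k) (x - y)).
    by apply: L1B => //; exact/L1Z/L1_poisson_shift.
  apply: le_trans (le_normr_Rintegral measurableT LB) _.
  apply: le_Rintegral => //; [exact: L1_norm|exact: hPe|].
  by move=> y _; rewrite -mulrBl normrM [X in _ * X]ger0_norm ?poisson_ge0.
rewrite -lee_fin fineK; last exact: integrable_fin_num (hPe _ e0).
have -> : eps = 6 * (eps / 6) by field.
exact: NP.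
Qed.

(** Differentiation needs local integrability only, and on a compact set [|f|] is dominated by the
    integrable function [f ^+ 2 + 1]. *)
Lemma ae_lebesgue_pt f : L2 f -> {ae mu, forall x, lebesgue_pt f x}.
Proof.
move=> [mf f2]; apply: lebesgue_differentiation; split=> //; first exact: openT.
move=> K _ cK.
have mK : measurable K by exact: compact_measurable.
have K1 : mu.-integrable K (EFin \o (fun x => f x ^+ 2 + 1)).
  have := @integrableD _ _ _ mu K mK (EFin \o (fun x => f x ^+ 2)) (cst 1%E).
  apply; first exact: integrableS f2.
  have := @continuous_compact_integrable R (cst 1) K cK.
  by apply; apply: continuous_subspaceT => ?; exact: cvg_cst.
apply: (le_lt_trans _ (@integrable_lty _ (measurableTypeR R) _ mu K mK _ K1)); apply: ge0_le_integral => //.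
- by apply/measurable_EFinP; apply: measurableT_comp => //; exact: measurable_funTS.
- exact: measurable_int K1.
- move=> y _; rewrite lee_fin ler_norml; apply/andP; split; nra.
Qed.

End poisson_lebesgue_points.

(** * Paley-Wiener functions *)

Section bandlimited.
Context {R : realType}.
Implicit Types (f g h w a b G : R -> R) (e x y xi c d : R).
Notation mu := (@lebesgue_measure R).

Lemma ae_imp (P Q : R -> Prop) : (forall x, P x -> Q x) ->
  {ae mu, forall x, P x} -> {ae mu, forall x, Q x}.
Proof.
move=> PQ [N [mN N0 PN]]; exists N; split=> // x /= nQ.
by apply: PN => /= Px; exact/nQ/PQ.
Qed.

Lemma ae_and (P Q : R -> Prop) : {ae mu, forall x, P x} ->
  {ae mu, forall x, Q x} -> {ae mu, forall x, P x /\ Q x}.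
Proof.
move=> aP aQ; apply: negligibleS (negligibleU aP aQ) => x /= nPQ.
by apply/not_andP.
Qed.

Lemma L2_cvg_pairing (h_ : nat -> R -> R) h w :
  (forall n, L2 (h_ n)) -> L2 h -> L2 w ->
  \int[mu]_x ((h_ n x - h x) ^+ 2) @[n --> \oo] --> (0 : R) ->
  \int[mu]_x (h_ n x * w x) @[n --> \oo] --> \int[mu]_x (h x * w x).
Proof.
move=> h_2 h2 w2 hh; apply/cvgrPdist_le => eps eps0.
have : \int[mu]_x ((h_ n x - h x) ^+ 2) * \int[mu]_x (w x ^+ 2) @[n --> \oo] --> (0 : R).
  rewrite -[X in _ --> X](mul0r (\int[mu]_x (w x ^+ 2))).
  by apply: cvgM => //; exact: cvg_cst.
move/cvgrPdist_le => /(_ (eps ^+ 2)); rewrite exprn_gt0// => /(_ isT).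
apply: filterS => n; rewrite sub0r normrN => H.
have := Cauchy_Schwarz (L2B (h_2 n) h2) w2.
move=> /le_trans/(_ (ler_norm _))/le_trans/(_ H).
have -> : \int[mu]_x ((h_ n x - h x) * w x) =
    \int[mu]_x (h_ n x * w x) - \int[mu]_x (h x * w x).
  rewrite -RintegralB//; [|exact: L2M|exact: L2M].
  by apply: eq_Rintegral => x _; rewrite mulrBl.
by rewrite -[X in X <= _ -> _]real_normK ?num_real// ler_pXn2r ?nnegrE ?(ltW eps0)// distrC.
Qed.

Lemma L2_cvg_sqr (h_ : nat -> R -> R) h :
  (forall n, L2 (h_ n)) -> L2 h ->
  \int[mu]_x ((h_ n x - h x) ^+ 2) @[n --> \oo] --> (0 : R) ->
  \int[mu]_x (h_ n x ^+ 2) @[n --> \oo] --> \int[mu]_x (h x ^+ 2).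
Proof.
move=> h_2 h2 hh; have P := L2_cvg_pairing h_2 h2 h2 hh.
have -> : (fun n => \int[mu]_x (h_ n x ^+ 2)) = (fun n =>
    \int[mu]_x ((h_ n x - h x) ^+ 2) + 2 * \int[mu]_x (h_ n x * h x) -
    \int[mu]_x (h x ^+ 2)).
  apply/funext => n; have B2 := (L2B (h_2 n) h2).2.
  rewrite -RintegralZl//; last exact: L2M.
  rewrite -RintegralD//; last exact/L1Z/L2M.
  rewrite -RintegralB//; [|by apply: L1D => //; exact/L1Z/L2M|exact: h2.2].
  by apply: eq_Rintegral => x _; ring.
have E : \int[mu]_x (h x ^+ 2) =
    0 + 2 * \int[mu]_x (h x * h x) - \int[mu]_x (h x ^+ 2).
  have -> : \int[mu]_x (h x * h x) = \int[mu]_x (h x ^+ 2) by [].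
  by ring.
rewrite [X in _ --> X]E; apply: cvgB; last exact: cvg_cst.
by apply: cvgD => //; apply: cvgM => //; exact: cvg_cst.
Qed.

Definition sinc (u : R) := sin (pi * u) / (pi * u).

(** The cosine and the sine have squared norms [(1 + sinc (2 * x)) / 2] and
    [(1 - sinc (2 * x)) / 2]. The cross term corresponds to the summand of [F] with [c * d], which
    is even and so cancels between the endpoints. *)
Lemma integral_trig_sqr c d x : 0 < x ->
  \int[mu]_(xi in `[- (1 / 2), 1 / 2])
     ((c * cos (2 * pi * x * xi) + d * sin (2 * pi * x * xi)) ^+ 2) =
  (c ^+ 2 + d ^+ 2) / 2 + (c ^+ 2 - d ^+ 2) / 2 * sinc (2 * x).
Proof.
move=> x0; set w := 2 * pi * x.
have w0 : 0 < w by rewrite !mulr_gt0 ?pi_gt0.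
pose F xi := (c ^+ 2 + d ^+ 2) / 2 * xi +
  (2 * w)^-1 * ((c ^+ 2 - d ^+ 2) / 2 * sin (2 * w * xi) + - (c * d) * cos (2 * w * xi)).
have dC k y : is_derive y (1 : R) (fun y => cos (k * y)) (- sin (k * y) * k).
  exact: is_derive_comp (is_derive_cos _) (is_derive_linear _ _).
have dS k y : is_derive y (1 : R) (fun y => sin (k * y)) (cos (k * y) * k).
  exact: is_derive_comp (is_derive_sin _) (is_derive_linear _ _).
have DF y : is_derive y (1 : R) F ((c * cos (w * y) + d * sin (w * y)) ^+ 2).
  have := is_derive_add (is_derive_linear ((c ^+ 2 + d ^+ 2) / 2) y)
    (is_derive_scale (2 * w)^-1 (is_derive_add
      (is_derive_scale ((c ^+ 2 - d ^+ 2) / 2) (dS (2 * w) y))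
      (is_derive_scale (- (c * d)) (dC (2 * w) y)))).
  congr is_derive.
  have -> : 2 * w * y = w * y + w * y by ring.
  rewrite cosD sinD; have := cos2Dsin2 (w * y).
  move: (cos (w * y)) (sin (w * y)) => C S CS.
  transitivity ((c ^+ 2 + d ^+ 2) / 2 * (C ^+ 2 + S ^+ 2) +
    ((c ^+ 2 - d ^+ 2) / 2 * (C * C - S * S) + c * d * (S * C + C * S))).
    by rewrite CS; field; rewrite gt_eqF.
  by field.
have cf : continuous (fun y => (c * cos (w * y) + d * sin (w * y)) ^+ 2).
  have cC : continuous (fun y => cos (w * y)) := is_derive_continuous (dC w).
  have cS : continuous (fun y => sin (w * y)) := is_derive_continuous (dS w).
  move=> y; apply: (@continuous_comp _ _ _ (fun y => c * cos (w * y) + d * sin (w * y)) (fun z => z ^+ 2)).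
    by apply: cvgD; apply: cvgM; [exact: cvg_cst|exact: cC|exact: cvg_cst|exact: cS].
  exact: exprn_continuous.
rewrite (FTC2_Rintegral _ cf DF); last by lra.
rewrite /F /sinc.
have -> : 2 * w * (1 / 2) = w by field.
have -> : 2 * w * (- (1 / 2)) = - w by field.
have -> : pi * (2 * x) = w by rewrite /w; ring.
by rewrite cosN sinN; field; rewrite gt_eqF.
Qed.

(* Bessel's inequality for the pair cos(2 pi x .), sin(2 pi x .), which is
   orthogonal on the symmetric interval [-1/2, 1/2]. *)
Lemma bessel_cos_sin G e x : L2 G -> 0 < e -> 0 < x ->
  {ae mu, forall xi, ~ `[- (1 / 2), 1 / 2]%classic xi -> G xi = 0} ->
  (\int[mu]_xi (G xi * (abel e xi * cos (2 * pi * x * xi)))) ^+ 2 +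
  (\int[mu]_xi (G xi * (abel e xi * sin (2 * pi * x * xi)))) ^+ 2 <=
  2^-1 * (1 + `|sinc (2 * x)|) * \int[mu]_xi (G xi ^+ 2).
Proof.
move=> G2 e0 x0 Gsupp.
set c := \int[mu]_xi (G xi * (abel e xi * cos _)).
set d := \int[mu]_xi (G xi * (abel e xi * sin _)).
set E := \int[mu]_xi (G xi ^+ 2).
have E0 : 0 <= E by apply: Rintegral_ge0 => xi _; exact: sqr_ge0.
pose I : set R := `[- (1 / 2), 1 / 2]%classic.
have mI : measurable I by exact: measurable_itv.
have muI : (mu I < +oo)%E.
  by rewrite /I lebesgue_measure_itv/=; case: ifP; rewrite ?ltry// -EFinB ltry.
(* The test function has the two pairings [c] and [d] as its own coefficients, so that pairing [G]
   with its weighted form returns [c ^+ 2 + d ^+ 2]. Cauchy-Schwarz then bounds the square of this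
   sum by a multiple of the sum, and one factor is cancelled. *)
pose T xi := c * cos (2 * pi * x * xi) + d * sin (2 * pi * x * xi).
have mT : measurable_fun [set: R] T.
  apply: measurable_funD; apply: measurable_funM => //.
    exact: measurable_cos_linear.
  exact: measurable_sin_linear.
have TM xi : `|T xi| <= `|c| + `|d|.
  rewrite (le_trans (ler_normD _ _))// !normrM lerD// ler_piMr//.
    exact: cos_max.
  exact: sin_max.
have A2 : L2 (abel e).
  apply: (@L1_L2_bounded _ _ 1); first exact: L1_abel.
  by move=> xi; rewrite ger0_norm ?abel_ge0// abel_le1.
have AT : L2 (fun xi => abel e xi * T xi) by exact: L2_bounded A2 mT TM.
have LC : L2 (fun xi => abel e xi * cos (2 * pi * x * xi)).
  apply: (@L2_bounded _ _ _ 1 A2); first exact: measurable_cos_linear.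
  by move=> xi; exact: cos_max.
have LS : L2 (fun xi => abel e xi * sin (2 * pi * x * xi)).
  apply: (@L2_bounded _ _ _ 1 A2); first exact: measurable_sin_linear.
  by move=> xi; exact: sin_max.
(* The cut-off to [I] leaves the pairing with [G] unchanged, since [G] vanishes outside [I], and
   reduces the norm of the test function to [integral_trig_sqr]. *)
have WL2 : L2 (fun xi => abel e xi * T xi * \1_I xi).
  apply: (@L2_bounded _ _ _ 1 AT); first exact: measurable_indic.
  by move=> xi; rewrite indicE; case: (_ \in _); rewrite ?normr1 ?normr0.
have GW : \int[mu]_xi (G xi * (abel e xi * T xi * \1_I xi)) = c ^+ 2 + d ^+ 2.
  transitivity (\int[mu]_xi (G xi * (abel e xi * T xi))).
    congr fine; apply: ae_eq_integral => //.
    - exact: measurable_int (L2M G2 WL2).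
    - exact: measurable_int (L2M G2 AT).
    - apply: ae_imp Gsupp => xi Gxi _.
      rewrite indicE; case: (boolP (xi \in I)) => [_|/negP xiI]; first by rewrite mulr1.
      by rewrite Gxi ?mul0r// => H; apply: xiI; rewrite inE.
  transitivity (\int[mu]_xi (c * (G xi * (abel e xi * cos (2 * pi * x * xi))) +
                             d * (G xi * (abel e xi * sin (2 * pi * x * xi))))).
    by apply: eq_Rintegral => xi _; rewrite /T; ring.
  have C1 := L2M G2 LC; have S1 := L2M G2 LS.
  rewrite RintegralD//; [|exact: L1Z|exact: L1Z].
  by rewrite !RintegralZl.
have WW : \int[mu]_xi ((abel e xi * T xi * \1_I xi) ^+ 2) <=
    2^-1 * (1 + `|sinc (2 * x)|) * (c ^+ 2 + d ^+ 2).
  apply: (@le_trans _ _ (\int[mu]_(xi in I) (T xi ^+ 2))).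
    rewrite [leRHS]Rintegral_mkcond.
    have LTI : L1 ((fun xi => T xi ^+ 2) \_ I).
      have : mu.-integrable I (EFin \o (fun xi => T xi ^+ 2)).
        apply: measurable_bounded_integrable => //.
        - by apply: measurable_funTS; exact: measurable_funX.
        - exists ((`|c| + `|d|) ^+ 2); split; first exact: num_real.
          move=> M /ltW HM xi _ /=; rewrite (le_trans _ HM)//.
          by rewrite normrX ler_pXn2r ?nnegrE ?addr_ge0// TM.
      move=> H; have := (@integrable_mkcond _ (measurableTypeR R) _ mu _ _ mI).1 H.
      by rewrite restrict_EFin.
    apply: le_Rintegral => //; first exact: WL2.2.
    move=> xi _; rewrite patchE indicE; case: (_ \in _); last by rewrite mulr0 expr0n.
    rewrite mulr1 exprMn ler_piMl ?sqr_ge0// expr_le1 ?abel_ge0//.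
    by rewrite abel_le1.
  rewrite integral_trig_sqr//.
  have : (c ^+ 2 - d ^+ 2) * sinc (2 * x) <= (c ^+ 2 + d ^+ 2) * `|sinc (2 * x)|.
    apply: (le_trans (ler_norm _)); rewrite normrM ler_wpM2r//.
    by rewrite ler_norml; have := sqr_ge0 c; have := sqr_ge0 d; lra.
  by lra.
set S := c ^+ 2 + d ^+ 2 in GW WW *.
have S0 : 0 <= S by rewrite addr_ge0 ?sqr_ge0.
have := Cauchy_Schwarz G2 WL2; rewrite GW => CS.
have {CS} : S ^+ 2 <= E * (2^-1 * (1 + `|sinc (2 * x)|) * S).
  by apply: (le_trans CS); rewrite ler_wpM2l.
move: S0; rewrite le_eqVlt => /predU1P[<- _|S0].
  by rewrite !mulr_ge0// addr_ge0.
have -> : E * (2^-1 * (1 + `|sinc (2 * x)|) * S) = 2^-1 * (1 + `|sinc (2 * x)|) * E * S.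
  by ring.
by rewrite expr2 ler_pM2r.
Qed.

End bandlimited.

(** * Complex functions through their real and imaginary parts *)

Section paley_wiener_bound.
Context {R : realType}.
Implicit Types (f g u v : R -> R[i]) (e x y xi : R).
Notation mu := (@lebesgue_measure R).

Definition re_part f : R -> R := fun x => complex.Re (f x).
Definition im_part f : R -> R := fun x => complex.Im (f x).

(** The squared norm as a real number; [L2norm] is extended-valued, and [L2norm_sqrt] links the
    two. *)
Definition sqnorm f : R :=
  \int[mu]_x (re_part f x ^+ 2) + \int[mu]_x (im_part f x ^+ 2).

Lemma normc_sqr (z : R[i]) :
  Normc.normc z ^+ 2 = complex.Re z ^+ 2 + complex.Im z ^+ 2.
Proof. by case: z => a b /=; rewrite sqr_sqrtr// addr_ge0 ?sqr_ge0. Qed.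

Lemma normc_ge0 (z : R[i]) : 0 <= Normc.normc z.
Proof. by case: z => a b /=; exact: sqrtr_ge0. Qed.

Let integral_sqr f :
  (\int[mu]_x (`|(Normc.normc (f x))%:E| `^ 2) =
   \int[mu]_x (re_part f x ^+ 2 + im_part f x ^+ 2)%:E)%E.
Proof.
apply: eq_integral => x _.
by rewrite abse_EFin ger0_norm ?normc_ge0// poweR_EFin powR_mulrn ?normc_ge0// normc_sqr.
Qed.

Lemma L2norm_sqrt f : L2 (re_part f) -> L2 (im_part f) ->
  L2norm f = (Num.sqrt (sqnorm f))%:E.
Proof.
move=> [_ f1] [_ f2]; rewrite /L2norm unlock integral_sqr.
rewrite -[X in (X `^ _)%E]fineK; last exact: integrable_fin_num (L1D f1 f2).
rewrite poweR_EFin powR12_sqrt; last first.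
  by apply: Rintegral_ge0 => x _; rewrite addr_ge0 ?sqr_ge0.
by congr (Num.sqrt _)%:E; exact: RintegralD.
Qed.

Lemma cL2_parts f : cL2 f -> L2 (re_part f) /\ L2 (im_part f).
Proof.
move=> [[m1 m2] fin].
have : (L2norm f `^ 2 < +oo)%E by exact: poweR_lty.
rewrite /L2norm poweR_Lnorm// integral_sqr => {}fin.
have L : L1 (fun x => re_part f x ^+ 2 + im_part f x ^+ 2).
  apply/integrableP; split.
    by apply/measurable_EFinP; apply: measurable_funD; exact: measurable_funX.
  rewrite (_ : (\int[mu]_x _)%E =
    (\int[mu]_x (re_part f x ^+ 2 + im_part f x ^+ 2)%:E)%E)//.
  by apply: eq_integral => x _; rewrite /= ger0_norm// addr_ge0 ?sqr_ge0.
split; split=> //.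
- apply: L1_le L _; first exact: measurable_funX.
  by move=> x; rewrite ger0_norm ?sqr_ge0// lerDl sqr_ge0.
- apply: L1_le L _; first exact: measurable_funX.
  by move=> x; rewrite ger0_norm ?sqr_ge0// lerDr sqr_ge0.
Qed.

Lemma fourierE u xi : cL1 u -> fourier u xi =
  ((costf (re_part u) xi + sintf (im_part u) xi) +i*
   (costf (im_part u) xi - sintf (re_part u) xi))%C.
Proof.
move=> [u1 u2].
rewrite /fourier /cintegral; congr (_ +i* _)%C.
- rewrite -RintegralD//; [|exact: L1_mul_cos|exact: L1_mul_sin].
  apply: eq_Rintegral => x _; rewrite /re_part /im_part /cis cosN sinN.
  by case: (u x) => a b /=; ring.
- rewrite -RintegralB//; [|exact: L1_mul_cos|exact: L1_mul_sin].
  apply: eq_Rintegral => x _; rewrite /re_part /im_part /cis cosN sinN.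
  by case: (u x) => a b /=; ring.
Qed.

(* The open set where [g] vanishes almost everywhere is covered by countably
   many rational intervals. *)
Lemma ae_eq0_out_esssupp g (A : set R) : esssupp g `<=` A ->
  {ae mu, forall x, ~ A x -> g x = 0}.
Proof.
move=> gA.
pose J (pq : rat * rat) : set R := `]ratr pq.1, ratr pq.2[%classic.
(* One almost-everywhere statement for each code [n] of a pair of rationals, so that [ae_foralln]
   can combine them. *)
pose P (n : nat) (x : R) := forall pq : rat * rat, unpickle n = Some pq ->
  {ae mu, forall y, J pq y -> g y = 0} -> J pq x -> g x = 0.
have aeP n : {ae mu, forall x, P n x}.
  rewrite /P; case: (unpickle n) => [pq|]; last first.
    by exists set0; split=> // x /=; apply.
  have [H|H] := pselect {ae mu, forall y, J pq y -> g y = 0}.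
    by apply: ae_imp H => x Hx pq' [<-] _; exact: Hx.
  by exists set0; split=> // x /=; apply => pq' [<-].
have := ae_foralln aeP; apply: ae_imp => x Px nAx.
have : ~ esssupp g x by move=> /gA.
rewrite /esssupp /= => /existsNP[U] /not_implyP[Ux] /contrapT H.
have [e /= e0 xU] := (nbhs_ballP _ _).1 Ux.
have /rat_in_itvoo[p] : x - e < x by rewrite ltrBlDr ltrDl.
rewrite in_itv/= => /andP[p1 p2].
have /rat_in_itvoo[q] : x < x + e by rewrite ltrDl.
rewrite in_itv/= => /andP[q1 q2].
apply: (Px (pickle (p, q)) (p, q)); first by rewrite pickleK.
  apply: ae_imp H => y Uy; rewrite /J /= in_itv/= => /andP[y1 y2]; apply: Uy.
  by apply: xU; rewrite /ball/= ltr_norml; apply/andP; split; lra.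
by rewrite /J /= in_itv/= p2 q1.
Qed.

Lemma L2norm_cvg0 (v : nat -> R -> R[i]) :
  (forall n, L2 (re_part (v n))) -> (forall n, L2 (im_part (v n))) ->
  (fun n => L2norm (v n)) @ \oo --> (0 : \bar R)%E ->
  \int[mu]_x (re_part (v n) x ^+ 2) @[n --> \oo] --> (0 : R) /\
  \int[mu]_x (im_part (v n) x ^+ 2) @[n --> \oo] --> (0 : R).
Proof.
move=> v1 v2; under eq_fun do rewrite L2norm_sqrt//.
move/fine_cvgP => [_]; rewrite /comp /= => vN.
have N0 n : 0 <= sqnorm (v n).
  by apply: addr_ge0; apply: Rintegral_ge0 => x _; exact: sqr_ge0.
have sN : sqnorm (v n) @[n --> \oo] --> (0 : R).
  rewrite -[X in _ --> X](mulr0 0).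
  under eq_fun do rewrite -[sqnorm _]sqr_sqrtr//.
  by apply: cvgM.
split.
- apply: (squeeze_cvgr _ (cvg_cst 0) sN); apply: nearW => n.
  rewrite Rintegral_ge0/=; last by move=> x _; exact: sqr_ge0.
  by rewrite lerDl; apply: Rintegral_ge0 => x _; exact: sqr_ge0.
- apply: (squeeze_cvgr _ (cvg_cst 0) sN); apply: nearW => n.
  rewrite Rintegral_ge0/=; last by move=> x _; exact: sqr_ge0.
  by rewrite lerDr; apply: Rintegral_ge0 => x _; exact: sqr_ge0.
Qed.

End paley_wiener_bound.

(** * Abel-weighted inversion in L^2 and the pointwise bound *)

Section paley_wiener_pointwise.
Context {R : realType}.
Implicit Types (f g u v : R -> R[i]) (e x y xi s t : R).
Notation mu := (@lebesgue_measure R).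

Let re_partB f g x : re_part (fun x => f x - g x) x = re_part f x - re_part g x.
Proof. by rewrite /re_part; case: (f x) (g x) => ? ? [? ?]. Qed.

Let im_partB f g x : im_part (fun x => f x - g x) x = im_part f x - im_part g x.
Proof. by rewrite /im_part; case: (f x) (g x) => ? ? [? ?]. Qed.

Lemma L2norm_cvg_parts (v : nat -> R -> R[i]) f :
  (forall n, L2 (re_part (v n))) -> (forall n, L2 (im_part (v n))) ->
  L2 (re_part f) -> L2 (im_part f) ->
  (fun n => L2norm (fun x => v n x - f x)) @ \oo --> (0 : \bar R)%E ->
  \int[mu]_x ((re_part (v n) x - re_part f x) ^+ 2) @[n --> \oo] --> (0 : R) /\
  \int[mu]_x ((im_part (v n) x - im_part f x) ^+ 2) @[n --> \oo] --> (0 : R).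
Proof.
move=> v1 v2 f1 f2.
have E1 n : re_part (fun x => v n x - f x) = (fun x => re_part (v n) x - re_part f x).
  by apply/funext => x; exact: re_partB.
have E2 n : im_part (fun x => v n x - f x) = (fun x => im_part (v n) x - im_part f x).
  by apply/funext => x; exact: im_partB.
move=> /L2norm_cvg0[n|n|].
- by rewrite E1; exact: L2B.
- by rewrite E2; exact: L2B.
- by under eq_fun do rewrite E1; under [X in _ -> X @ _ --> _ -> _]eq_fun do rewrite E2.
Qed.

(** Both sides of each identity are continuous under L^2 convergence: the left pairs [g] with a
    weighted cosine or sine, the right pairs [f] with Poisson kernels. So they need checking only
    for the approximants [u n], whose transforms are combinations of [costf] and [sintf]; the
    transform of the wrong parity gives an odd integrand and drops out. The norm inequality passes
    to the limit in the same way. *)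
Lemma fourierL2_identities f g : is_fourierL2 f g ->
  sqnorm g <= sqnorm f /\ forall e x, 0 < e ->
  [/\ \int[mu]_xi (re_part g xi * (abel e xi * cos (2 * pi * x * xi))) =
        2^-1 * (poisson_conv (re_part f) e x + poisson_conv (re_part f) e (- x)),
      \int[mu]_xi (im_part g xi * (abel e xi * cos (2 * pi * x * xi))) =
        2^-1 * (poisson_conv (im_part f) e x + poisson_conv (im_part f) e (- x)),
      \int[mu]_xi (re_part g xi * (abel e xi * sin (2 * pi * x * xi))) =
        2^-1 * (poisson_conv (im_part f) e x - poisson_conv (im_part f) e (- x)) &
      \int[mu]_xi (im_part g xi * (abel e xi * sin (2 * pi * x * xi))) =
        - (2^-1 * (poisson_conv (re_part f) e x - poisson_conv (re_part f) e (- x)))].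
Proof.
move=> [/cL2_parts[f1 f2] /cL2_parts[g1 g2] [u [u12 uf ug]]].
pose a n := re_part (u n); pose b n := im_part (u n).
have a1 n : L1 (a n) by have [[]] := u12 n.
have b1 n : L1 (b n) by have [[]] := u12 n.
have a2 n : L2 (a n) by have [_ /cL2_parts[]] := u12 n.
have b2 n : L2 (b n) by have [_ /cL2_parts[]] := u12 n.
have re_hat n : re_part (fourier (u n)) = fun xi => costf (a n) xi + sintf (b n) xi.
  by apply/funext => xi; rewrite /re_part fourierE//; exact: (u12 n).1.
have im_hat n : im_part (fourier (u n)) = fun xi => costf (b n) xi - sintf (a n) xi.
  by apply/funext => xi; rewrite /im_part fourierE//; exact: (u12 n).1.
have [af bf] := L2norm_cvg_parts a2 b2 f1 f2 uf.
have rehat2 n : L2 (re_part (fourier (u n))).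
  by rewrite re_hat; have [] := complex_plancherel_le (a1 n) (a2 n) (b1 n) (b2 n).
have imhat2 n : L2 (im_part (fourier (u n))).
  by rewrite im_hat; have [] := complex_plancherel_le (a1 n) (a2 n) (b1 n) (b2 n).
have [hg1 hg2] := L2norm_cvg_parts rehat2 imhat2 g1 g2 ug.
split.
  have cf : sqnorm (u n) @[n --> \oo] --> sqnorm f.
    by apply: cvgD; exact: L2_cvg_sqr.
  have cg : sqnorm (fourier (u n)) @[n --> \oo] --> sqnorm g.
    by apply: cvgD; exact: L2_cvg_sqr.
  apply: (ler_cvg_to cg cf); apply: nearW => n.
  rewrite /sqnorm re_hat im_hat.
  by have [] := complex_plancherel_le (a1 n) (a2 n) (b1 n) (b2 n).
move=> e x e0.
have LC := L1_abel_cos (2 * pi * x) e0; have LS := L1_abel_sin (2 * pi * x) e0.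
have bound (t : R -> R) xi : `|t xi| <= 1 -> `|abel e xi * t xi| <= 1.
  move=> t1; rewrite normrM mulr_ile1// ger0_norm ?abel_ge0//.
  exact: abel_le1.
have LC2 : L2 (fun xi => abel e xi * cos (2 * pi * x * xi)).
  apply: (L1_L2_bounded LC) => xi.
  by apply: (bound (fun xi => cos (2 * pi * x * xi))); exact: cos_max.
have LS2 : L2 (fun xi => abel e xi * sin (2 * pi * x * xi)).
  apply: (L1_L2_bounded LS) => xi.
  by apply: (bound (fun xi => sin (2 * pi * x * xi))); exact: sin_max.
have conv_cvg (c : nat -> R -> R) h y : (forall n, L2 (c n)) -> L2 h ->
    \int[mu]_x ((c n x - h x) ^+ 2) @[n --> \oo] --> (0 : R) ->
    poisson_conv (c n) e y @[n --> \oo] --> poisson_conv h e y.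
  by move=> c2 h2 ch; exact: L2_cvg_pairing c2 h2 (L2_poisson_shift y e0) ch.
have La n y := conv_cvg a (re_part f) y a2 f1 af.
have Lb n y := conv_cvg b (im_part f) y b2 f2 bf.
have CC c (c1 : L1 c) : L1 (fun xi => costf c xi * (abel e xi * cos (2 * pi * x * xi))).
  under eq_fun do rewrite mulrC.
  by apply: L1_bounded LC (measurable_costf c1) _ => xi; exact: costf_le.
have CS c (c1 : L1 c) : L1 (fun xi => costf c xi * (abel e xi * sin (2 * pi * x * xi))).
  under eq_fun do rewrite mulrC.
  by apply: L1_bounded LS (measurable_costf c1) _ => xi; exact: costf_le.
have SC c (c1 : L1 c) : L1 (fun xi => sintf c xi * (abel e xi * cos (2 * pi * x * xi))).
  under eq_fun do rewrite mulrC.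
  by apply: L1_bounded LC (measurable_sintf c1) _ => xi; exact: sintf_le.
have SS c (c1 : L1 c) : L1 (fun xi => sintf c xi * (abel e xi * sin (2 * pi * x * xi))).
  under eq_fun do rewrite mulrC.
  by apply: L1_bounded LS (measurable_sintf c1) _ => xi; exact: sintf_le.
have ICC c (c1 : L1 c) : \int[mu]_xi (costf c xi * (abel e xi * cos (2 * pi * x * xi))) =
    2^-1 * (poisson_conv c e x + poisson_conv c e (- x)).
  by rewrite -integral_costf_abel//; apply: eq_Rintegral => xi _; rewrite mulrC.
have ISS c (c1 : L1 c) : \int[mu]_xi (sintf c xi * (abel e xi * sin (2 * pi * x * xi))) =
    2^-1 * (poisson_conv c e x - poisson_conv c e (- x)).
  by rewrite -integral_sintf_abel//; apply: eq_Rintegral => xi _; rewrite mulrC.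
have ICS c (c1 : L1 c) : \int[mu]_xi (costf c xi * (abel e xi * sin (2 * pi * x * xi))) = 0.
  apply: Rintegral_odd; first exact: CS.
  by move=> xi; rewrite costfN /abel normrN [_ * - xi]mulrN sinN !mulrN.
have ISC c (c1 : L1 c) : \int[mu]_xi (sintf c xi * (abel e xi * cos (2 * pi * x * xi))) = 0.
  apply: Rintegral_odd; first exact: SC.
  by move=> xi; rewrite sintfN// /abel normrN [_ * - xi]mulrN cosN mulNr.
have cvg_sum (c : nat -> R -> R) h :
    (forall y, poisson_conv (c n) e y @[n --> \oo] --> poisson_conv h e y) ->
    2^-1 * (poisson_conv (c n) e x + poisson_conv (c n) e (- x)) @[n --> \oo] -->
    2^-1 * (poisson_conv h e x + poisson_conv h e (- x)).
  by move=> H; apply: cvgM; [exact: cvg_cst|exact: cvgD].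
have cvg_diff (c : nat -> R -> R) h :
    (forall y, poisson_conv (c n) e y @[n --> \oo] --> poisson_conv h e y) ->
    2^-1 * (poisson_conv (c n) e x - poisson_conv (c n) e (- x)) @[n --> \oo] -->
    2^-1 * (poisson_conv h e x - poisson_conv h e (- x)).
  by move=> H; apply: cvgM; [exact: cvg_cst|exact: cvgB].
have reC n : \int[mu]_xi (re_part (fourier (u n)) xi * (abel e xi * cos (2 * pi * x * xi))) =
    2^-1 * (poisson_conv (a n) e x + poisson_conv (a n) e (- x)).
  apply: etrans (ICC _ (a1 n)); rewrite re_hat -[RHS]addr0 -(ISC _ (b1 n)).
  rewrite -RintegralD//; [|exact: CC|exact: SC].
  by apply: eq_Rintegral => xi _; rewrite mulrDl.
have imC n : \int[mu]_xi (im_part (fourier (u n)) xi * (abel e xi * cos (2 * pi * x * xi))) =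
    2^-1 * (poisson_conv (b n) e x + poisson_conv (b n) e (- x)).
  apply: etrans (ICC _ (b1 n)); rewrite im_hat -[RHS]subr0 -(ISC _ (a1 n)).
  rewrite -RintegralB//; [|exact: CC|exact: SC].
  by apply: eq_Rintegral => xi _; rewrite mulrBl.
have reS n : \int[mu]_xi (re_part (fourier (u n)) xi * (abel e xi * sin (2 * pi * x * xi))) =
    2^-1 * (poisson_conv (b n) e x - poisson_conv (b n) e (- x)).
  apply: etrans (ISS _ (b1 n)); rewrite re_hat -[RHS]add0r -(ICS _ (a1 n)).
  rewrite -RintegralD//; [|exact: CS|exact: SS].
  by apply: eq_Rintegral => xi _; rewrite mulrDl.
have imS n : \int[mu]_xi (im_part (fourier (u n)) xi * (abel e xi * sin (2 * pi * x * xi))) =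
    - (2^-1 * (poisson_conv (a n) e x - poisson_conv (a n) e (- x))).
  apply: etrans (congr1 -%R (ISS _ (a1 n))).
  rewrite im_hat -[RHS]add0r -(ICS _ (b1 n)).
  rewrite -RintegralB//; [|exact: CS|exact: SS].
  by apply: eq_Rintegral => xi _; rewrite mulrBl.
split.
- have := L2_cvg_pairing rehat2 g1 LC2 hg1; rewrite (funext reC).
  by move/cvg_unique; apply => //; apply: cvg_sum => y; exact: La.
- have := L2_cvg_pairing imhat2 g2 LC2 hg2; rewrite (funext imC).
  by move/cvg_unique; apply => //; apply: cvg_sum => y; exact: Lb.
- have := L2_cvg_pairing rehat2 g1 LS2 hg1; rewrite (funext reS).
  by move/cvg_unique; apply => //; apply: cvg_diff => y; exact: Lb.
- have := L2_cvg_pairing imhat2 g2 LS2 hg2; rewrite (funext imS).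
  by move/cvg_unique; apply => //; apply: cvgN; apply: cvg_diff => y; exact: La.
Qed.

(** For fixed [e], Bessel's inequality for [re_part g] and for [im_part g] bounds the squares of the
    even and odd parts of both Poisson integrals. By the parallelogram law these squares add up to
    half of the sum of squares at [x] and [- x], which removes the factor [1 / 2]. Then [e] runs
    through the powers of [1 / 2]. *)
Lemma PW2_pointwise f : PW2 f ->
  {ae mu, forall x, 0 < x ->
    (re_part f x ^+ 2 + im_part f x ^+ 2) +
    (re_part f (- x) ^+ 2 + im_part f (- x) ^+ 2) <=
    (1 + `|sinc (2 * x)|) * sqnorm f}.
Proof.
move=> [g fg supp]; have [gf ids] := fourierL2_identities fg.
have [/cL2_parts[f1 f2] /cL2_parts[g1 g2] _] := fg.
have g0 := ae_eq0_out_esssupp supp.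
have g10 : {ae mu, forall xi, ~ `[- (1 / 2), 1 / 2]%classic xi -> re_part g xi = 0}.
  by apply: ae_imp g0 => xi H /H; rewrite /re_part => ->.
have g20 : {ae mu, forall xi, ~ `[- (1 / 2), 1 / 2]%classic xi -> im_part g xi = 0}.
  by apply: ae_imp g0 => xi H /H; rewrite /im_part => ->.
have key e x : 0 < e -> 0 < x ->
  (poisson_conv (re_part f) e x ^+ 2 + poisson_conv (im_part f) e x ^+ 2) +
  (poisson_conv (re_part f) e (- x) ^+ 2 + poisson_conv (im_part f) e (- x) ^+ 2) <=
  (1 + `|sinc (2 * x)|) * sqnorm f.
  move=> e0 x0; have [i1 i2 i3 i4] := ids e x e0.
  have := bessel_cos_sin g1 e0 x0 g10; have := bessel_cos_sin g2 e0 x0 g20.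
  rewrite i1 i2 i3 i4; set k := 1 + `|sinc (2 * x)|.
  have k0 : 0 <= k by rewrite addr_ge0.
  have : k * sqnorm g <= k * sqnorm f by rewrite ler_wpM2l.
  rewrite /sqnorm; lra.
have A1 := ae_lebesgue_pt f1; have A2 := ae_lebesgue_pt f2.
(* The bound involves [- x] as well, which must also be a Lebesgue point. *)
have M1 := ae_preserving preserves_lebesgue_opp A1.
have M2 := ae_preserving preserves_lebesgue_opp A2.
apply: ae_imp (ae_and (ae_and A1 A2) (ae_and M1 M2)) => x [[l1 l2] [m1 m2]] x0.
have ek k : 0 < 2^-1 ^+ k :> R by rewrite exprn_gt0// invr_gt0.
have sq_cvg h y : L2 h -> lebesgue_pt h y ->
    poisson_conv h (2^-1 ^+ k) y ^+ 2 @[k --> \oo] --> h y ^+ 2.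
  move=> h2 hy; have H := poisson_conv_lebesgue_pt h2 hy.
  by under eq_fun do rewrite expr2; rewrite expr2; exact: cvgM.
apply: (cvgr_to_le (cvgD (cvgD (sq_cvg _ _ f1 l1) (sq_cvg _ _ f2 l2))
  (cvgD (sq_cvg _ _ f1 m1) (sq_cvg _ _ f2 m2)))).
by apply: nearW => k; exact: key.
Qed.

End paley_wiener_pointwise.

(** * The concentration function *)

Section concentration_increments.
Context {R : realType}.
Implicit Types (f : R -> R[i]) (s t x B : R).
Notation mu := (@lebesgue_measure R).

Let dens f x : R := re_part f x ^+ 2 + im_part f x ^+ 2.

Let dens_ge0 f x : 0 <= dens f x.
Proof. by rewrite addr_ge0 ?sqr_ge0. Qed.

Let L1_dens f : L2 (re_part f) -> L2 (im_part f) -> L1 (dens f).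
Proof. by move=> [_ f1] [_ f2]; exact: L1D. Qed.

Let PW2_L2 f : PW2 f -> L2 (re_part f) /\ L2 (im_part f).
Proof. by move=> [g [/cL2_parts]]. Qed.

Let integrable_dens f (A : set R) : L2 (re_part f) -> L2 (im_part f) ->
  measurable A -> mu.-integrable A (EFin \o dens f).
Proof.
move=> f1 f2 mA.
exact: (@integrableS _ (measurableTypeR R) _ mu _ _ _ measurableT mA (@subsetT _ A) (L1_dens f1 f2)).
Qed.

Lemma concentrationE s f : L2 (re_part f) -> L2 (im_part f) ->
  ((concentration s f)%:E = \int[mu]_(x in `[(- (s / 2))%R, (s / 2)%R]) (dens f x)%:E)%E.
Proof.
move=> f1 f2; rewrite -[RHS]fineK; last first.
  by apply: integrable_fin_num => //; exact: integrable_dens.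
by congr (fine _)%:E; apply: eq_integral => x _; rewrite normc_sqr.
Qed.

Let measurable_dens f (A : set R) : L2 (re_part f) -> L2 (im_part f) ->
  measurable_fun A (fun x => (dens f x)%:E).
Proof.
move=> f1 f2; apply: (measurable_funS measurableT (@subsetT _ A)).
exact: measurable_int (L1_dens f1 f2).
Qed.

Lemma concentration_ge0 s f : 0 <= concentration s f.
Proof. by apply: Rintegral_ge0 => x _; exact: sqr_ge0. Qed.

Lemma concentration_le s t f : PW2 f -> s <= t -> concentration s f <= concentration t f.
Proof.
move=> /PW2_L2[f1 f2] st; rewrite -lee_fin !concentrationE//.
apply: ge0_subset_integral => //.
- exact: measurable_dens.
- by move=> x _; rewrite lee_fin.
- by apply: subset_itv; rewrite bnd_simp; lra.
Qed.

Lemma concentration_le_sqnorm s f : PW2 f -> concentration s f <= sqnorm f.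
Proof.
move=> /PW2_L2[f1 f2]; rewrite -lee_fin concentrationE//.
have -> : (sqnorm f)%:E = (\int[mu]_x (dens f x)%:E)%E.
  rewrite -[RHS]fineK; last by apply: integrable_fin_num => //; exact: L1_dens.
  by congr EFin; apply/esym/RintegralD => //; [exact: f1.2|exact: f2.2].
apply: ge0_subset_integral => //.
- exact: measurable_dens.
- by move=> x _; rewrite lee_fin.
Qed.

(** Reflection folds the left half [J'] of the shell onto [J]. There the pointwise bound holds with
    [u = 2 * x] between [s] and [t], and [J] has length [(t - s) / 2], which absorbs the factor 2 of
    [2 * B]. *)
Lemma concentration_increment s t B f : PW2 f -> 0 < s -> s < t ->
  (forall u, s <= u <= t -> (1 + `|sinc u|) * sqnorm f <= 2 * B) ->
  concentration t f <= concentration s f + (t - s) * B.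
Proof.
move=> Pf s0 st HB; have [f1 f2] := PW2_L2 Pf.
rewrite -lee_fin EFinD !concentrationE//.
have mI (a b : R) : measurable `[a, b]%classic by exact: measurable_itv.
pose J : set R := `](s / 2), (t / 2)]%classic.
have mJ : measurable J by exact: measurable_itv.
have mD A : measurable_fun A (fun x => (dens f x)%:E) by exact: measurable_dens.
have D0 (x : R) : (0 <= (dens f x)%:E)%E by rewrite lee_fin.
pose J' : set R := -%R @^-1` J.
have mJ' : measurable J'.
  by rewrite /J' opp_preimage_itvbndbnd; exact: measurable_itv.
have sub : `[- (t / 2), t / 2]%classic `<=` `[- (s / 2), s / 2]%classic `|` (J `|` J').
  move=> x /=; rewrite /J' /J /= !in_itv/= => /andP[x1 x2].
  have [xs|xs] := leP x (s / 2); last by right; left; rewrite x2.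
  have [xs'|xs'] := leP (- (s / 2)) x; first by left.
  by right; right; apply/andP; split; lra.
apply: (@le_trans _ _ (\int[mu]_(x in `[(- (s / 2))%R, (s / 2)%R] `|` (J `|` J')) (dens f x)%:E)%E).
  apply: ge0_subset_integral => //.
  - by apply: measurableU => //; exact: measurableU.
  - exact: mD.
rewrite ge0_integral_setU//; last 3 first.
- exact: measurableU.
- exact: mD.
- apply/disj_setPS => x [/=]; rewrite /J' /J /= !in_itv/= => /andP[x1 x2] [/andP[x3 _]|/andP[x3 _]]; lra.
rewrite leeD2l// ge0_integral_setU//; last 2 first.
- exact: mD.
- apply/disj_setPS => x [/=]; rewrite /J' /J /= !in_itv/= => /andP[x1 x2] /andP[x3 _]; lra.
have mDN : measurable_fun J (fun x => (dens f (- x))%:E).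
  apply: measurable_funTS; apply/measurable_EFinP.
  apply: (measurableT_comp (L1_measurable (L1_dens f1 f2))).
  exact: oppr_measurable.
have -> : (\int[mu]_(x in J') (dens f x)%:E = \int[mu]_(x in J) (dens f (- x))%:E)%E.
  have := @ge0_integral_preserving R -%R (fun x => (dens f (- x))%:E)%E J
    (@preserves_lebesgue_opp R) mJ mDN.
  rewrite -/J' => <-; last by [].
  by apply: eq_integral => x _; rewrite opprK.
rewrite -ge0_integralD//; last exact: mD.
apply: (@le_trans _ _ (\int[mu]_(x in J) (2 * B)%:E)%E); last first.
  have muJ : mu J = ((t - s) / 2)%:E.
    by rewrite /J lebesgue_measure_itv/= lte_fin ltr_pM2r ?invr_gt0// st -EFinB mulrBl.
  have -> : (\int[mu]_(x in J) (2 * B)%:E = (2 * B)%:E * mu J)%E by exact: integral_cst.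
  by rewrite muJ -EFinM lee_fin; lra.
have B0 : 0 <= 2 * B.
  apply: le_trans (HB s _); last by rewrite lexx ltW.
  by rewrite mulr_ge0 ?addr_ge0// Rintegral_ge0// => x _; exact: sqr_ge0.
apply: ae_ge0_le_integral => //.
- by move=> x _; rewrite adde_ge0.
- by apply: emeasurable_funD => //; exact: mD.
apply: ae_imp (PW2_pointwise Pf) => x H.
rewrite /J /= in_itv/= => /andP[x1 x2]; rewrite -EFinD lee_fin.
apply: (le_trans (H _)); first by lra.
by apply: HB; apply/andP; split; lra.
Qed.

Let admissible : set (R -> R[i]) := [set f | PW2 f /\ L2norm f = 1%E].

Let sqnorm1 f : admissible f -> sqnorm f = 1.
Proof.
move=> [/PW2_L2[f1 f2]]; rewrite L2norm_sqrt// => -[] /(congr1 (fun z => z ^+ 2)).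
rewrite sqr_sqrtr ?expr1n// addr_ge0//; apply: Rintegral_ge0 => x _; exact: sqr_ge0.
Qed.

Let has_sup_conc s : admissible !=set0 ->
  has_sup [set concentration s f | f in admissible].
Proof.
move=> [f fA]; split; first by exists (concentration s f), f.
exists 1 => _ [h hA <-]; rewrite -(sqnorm1 hA).
by apply: concentration_le_sqnorm; exact: hA.1.
Qed.

Lemma lambda_increment s t B : 0 < s -> s < t -> 0 <= B ->
  (forall u, s <= u <= t -> 1 + `|sinc u| <= 2 * B) ->
  lambda t <= lambda s + (t - s) * B.
Proof.
move=> s0 st B0 HB; rewrite /lambda -/admissible.
(* Without admissible functions both values are the default [sup set0 = 0]. *)
have [A0|/set0P A0] := eqVneq admissible set0.
  by rewrite A0 !image_set0 sup0 add0r mulr_ge0// subr_ge0 ltW.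
apply: ge_sup; first by case: (has_sup_conc t A0).
move=> _ [f fA <-].
apply: (@le_trans _ _ (concentration s f + (t - s) * B)).
  apply: concentration_increment => //; first exact: fA.1.
  by move=> u; rewrite (sqnorm1 fA) mulr1; exact: HB.
by rewrite lerD2r; apply: ub_le_sup; [exact: (has_sup_conc s A0).2|exists f].
Qed.

Lemma lambda_nondecreasing s t : s <= t -> lambda s <= lambda t.
Proof.
move=> st; rewrite /lambda -/admissible.
have [A0|/set0P A0] := eqVneq admissible set0; first by rewrite A0 !image_set0.
apply: ge_sup; first by case: (has_sup_conc s A0).
move=> _ [f fA <-]; apply: (@le_trans _ _ (concentration t f)).
  by apply: concentration_le => //; exact: fA.1.
by apply: ub_le_sup; [exact: (has_sup_conc t A0).2|exists f].
Qed.

Lemma lambda_ge0 s : 0 <= lambda s :> R.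
Proof.
rewrite /lambda -/admissible.
have [A0|/set0P A0] := eqVneq admissible set0; first by rewrite A0 !image_set0 sup0.
have [f fA] := A0; apply: (le_trans (concentration_ge0 s f)).
by apply: ub_le_sup; [exact: (has_sup_conc s A0).2|exists f].
Qed.

Lemma lambda_le1 s : lambda s <= 1 :> R.
Proof.
rewrite /lambda -/admissible.
have [A0|/set0P A0] := eqVneq admissible set0; first by rewrite A0 !image_set0 sup0.
apply: ge_sup; first by case: (has_sup_conc s A0).
move=> _ [f fA <-]; rewrite -(sqnorm1 fA).
by apply: concentration_le_sqnorm; exact: fA.1.
Qed.

End concentration_increments.

(** * Asymptotics *)

Section real_estimates.
Context {R : realType}.
Implicit Types (x y q : R).
Notation mu := (@lebesgue_measure R).

Lemma ge0_of_derive (h dh : R -> R) : (forall x, is_derive x (1 : R) h (dh x)) ->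
  (forall x, 0 <= x -> 0 <= dh x) -> 0 <= h 0 -> forall y, 0 <= y -> 0 <= h y.
Proof.
move=> Dh dh0 h0 y y0.
have [c] := @MVT_segment R h dh 0 y y0 (fun x _ => Dh x)
  (continuous_subspaceT (is_derive_continuous Dh)).
rewrite in_itv/= subr0 => /andP[c0 _] E.
by have : 0 <= dh c * y := mulr_ge0 (dh0 c c0) y0; lra.
Qed.

Let dX (n : nat) (k x : R) :
  is_derive x (1 : R) (fun x => k * x ^+ n.+1) (k * (n.+1%:R * x ^+ n)).
Proof.
apply: is_derive_scale; elim: n => [|n IH].
  by rewrite expr0 mulr1; under eq_fun do rewrite expr1; exact: is_derive_id.
under eq_fun do rewrite exprS.
have := is_derive_mul (is_derive_id x (1 : R)) IH; congr is_derive.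
by rewrite -[n.+2]addn1 natrD exprS; ring.
Qed.

(** Five integrations from 0 starting with [cos <= 1]: the left-hand side of each inequality is the
    derivative of that of the next. *)
Lemma sin_le_taylor5 y : 0 <= y -> sin y <= y - y ^+ 3 / 6 + y ^+ 5 / 120.
Proof.
move=> y0.
have S1 x : 0 <= x -> 0 <= 1 * x + -1 * sin x.
  apply: (@ge0_of_derive (fun x => 1 * x + -1 * sin x)
    (fun x => 1 + -1 * cos x)).
  - by move=> z; exact: is_derive_add (is_derive_linear _ _) (is_derive_scale _ (is_derive_sin z)).
  - by move=> z _; have := cos_le1 z; lra.
  - by rewrite sin0; lra.
have C2 x : 0 <= x -> 0 <= cos x + (-1 + 2^-1 * x ^+ 2).
  apply: (@ge0_of_derive (fun x => cos x + (-1 + 2^-1 * x ^+ 2))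
    (fun x => 1 * x + -1 * sin x)).
  - move=> z; have := is_derive_add (is_derive_cos z)
      (is_derive_add (is_derive_cst (-1 : R) z (1 : R)) (dX 1 2^-1 z)).
    by congr is_derive; rewrite add0r expr1; field.
  - exact: S1.
  - by rewrite cos0 expr0n/=; lra.
have S3 x : 0 <= x -> 0 <= sin x + (-1 * x + 6^-1 * x ^+ 3).
  apply: (@ge0_of_derive (fun x => sin x + (-1 * x + 6^-1 * x ^+ 3))
    (fun x => cos x + (-1 + 2^-1 * x ^+ 2))).
  - move=> z; have := is_derive_add (is_derive_sin z)
      (is_derive_add (is_derive_linear (-1 : R) z) (dX 2 6^-1 z)).
    by congr is_derive; field.
  - exact: C2.
  - by rewrite sin0 expr0n/=; lra.
have C4 x : 0 <= x -> 0 <= -1 * cos x + (1 + (- 2^-1 * x ^+ 2 + 24^-1 * x ^+ 4)).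
  apply: (@ge0_of_derive (fun x => -1 * cos x + (1 + (- 2^-1 * x ^+ 2 + 24^-1 * x ^+ 4)))
    (fun x => sin x + (-1 * x + 6^-1 * x ^+ 3))).
  - move=> z; have := is_derive_add (is_derive_scale (-1) (is_derive_cos z))
      (is_derive_add (is_derive_cst (1 : R) z (1 : R)) (is_derive_add (dX 1 (- 2^-1) z) (dX 3 24^-1 z))).
    by congr is_derive; rewrite expr1; field.
  - exact: S3.
  - by rewrite cos0 !expr0n/=; lra.
have S5 x : 0 <= x -> 0 <= -1 * sin x + (1 * x + (- 6^-1 * x ^+ 3 + 120^-1 * x ^+ 5)).
  apply: (@ge0_of_derive (fun x => -1 * sin x + (1 * x + (- 6^-1 * x ^+ 3 + 120^-1 * x ^+ 5)))
    (fun x => -1 * cos x + (1 + (- 2^-1 * x ^+ 2 + 24^-1 * x ^+ 4)))).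
  - move=> z; have := is_derive_add (is_derive_scale (-1) (is_derive_sin z))
      (is_derive_add (is_derive_linear (1 : R) z) (is_derive_add (dX 2 (- 6^-1) z) (dX 4 120^-1 z))).
    by congr is_derive; field.
  - exact: C4.
  - by rewrite sin0 !expr0n/=; lra.
by have := S5 y y0; lra.
Qed.

(** On this range [sin (pi * x) >= 0], so the absolute value disappears. The Taylor bound, divided
    by [pi * x], is put into the exponent by [1 + z <= expR z], ready to be raised to the power
    [q / 2]. *)
Lemma sinc_le_near x : 0 < x -> x <= 1 ->
  2^-1 * (1 + `|sinc x|) <= expR (- (pi * x) ^+ 2 / 12 + (pi * x) ^+ 4 / 240).
Proof.
move=> x0 x1; set y := pi * x; have y0 : 0 < y by rewrite mulr_gt0 ?pi_gt0.
have s0 : 0 <= sin y.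
  apply: sin_ge0_pi; rewrite ltW//= /y -[leRHS]mulr1 ler_wpM2l//.
  exact: pi_ge0.
rewrite /sinc -/y ger0_norm ?divr_ge0 ?(ltW y0)//.
apply: le_trans (expR_ge1Dx _).
have := sin_le_taylor5 (ltW y0).
rewrite -(@ler_pM2r _ y^-1) ?invr_gt0// => H.
have E : (y - y ^+ 3 / 6 + y ^+ 5 / 120) / y = 1 - y ^+ 2 / 6 + y ^+ 4 / 120.
  by field; rewrite gt_eqF.
rewrite E in H; lra.
Qed.

Lemma sinc_le_far x : 1 <= x -> 2^-1 * (1 + `|sinc x|) <= 3 / 4.
Proof.
move=> x1; have y2 : 2 <= pi * x.
  by rewrite -[2]mulr1 ler_pM// pi_ge2.
have : `|sinc x| <= 2^-1.
  rewrite /sinc normrM normfV [X in _ / X]ger0_norm; last by lra.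
  rewrite ler_pdivrMr; last by lra.
  by apply: (le_trans (sin_max _)); lra.
by lra.
Qed.

Lemma sinc_continuous x : 0 < x -> {for x, continuous (@sinc R)}.
Proof.
move=> x0; apply: cvgM.
  apply: (@continuous_comp _ _ _ (fun x : R => pi * x) sin).
    by apply: cvgM; [exact: cvg_cst|exact: cvg_id].
  exact: continuous_sin.
apply: cvgV; first by rewrite gt_eqF// mulr_gt0 ?pi_gt0.
by apply: cvgM; [exact: cvg_cst|exact: cvg_id].
Qed.

Lemma integral0y_gauss_scale (k : R) : 0 < k ->
  (\int[mu]_(x in `[0%R, +oo[) (expR (- (k * x) ^+ 2))%:E = (Num.sqrt pi / (2 * k))%:E)%E.
Proof.
move=> k0; pose F (x : R) := k * x.
have dF x : is_derive x (1 : R) F k by exact: is_derive_linear.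
have F1 : derive1 F = cst k by apply/funext => x; exact: is_derive_derive1.
have cF : continuous F := is_derive_continuous dF.
have := @increasing_ge0_integration_by_substitutiony R F (@gauss_fun R) 0.
rewrite F1 /F mulr0 integral0y_gauss => H.
have {H} : (Num.sqrt pi / 2)%:E =
    (\int[mu]_(x in `[0%R, +oo[) (k%:E * (expR (- (k * x) ^+ 2))%:E))%E.
  rewrite H.
  - by apply: eq_integral => x _; rewrite -EFinM mulrC.
  - by move=> x y _ _ xy; rewrite ltr_pM2l.
  - by move=> x _; exact: cvg_cst.
  - by apply/cvg_ex; exists k; exact: cvg_cst.
  - by apply/cvg_ex; exists k; exact: cvg_cst.
  - split; first by move=> x _; have [] := dF x.
    exact/cvg_at_right_filter/cF.
  - by apply: gt0_cvgMry => //; exact: cvg_id.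
  - by apply: continuous_subspaceT; exact: continuous_gauss_fun.
  - by move=> x _; exact: gauss_fun_ge0.
have mg : measurable_fun [set: R] (fun x => expR (- (k * x) ^+ 2)).
  apply: (measurableT_comp (@measurable_gauss_fun R)).
  exact: measurable_funM.
rewrite ge0_integralZl//; last 2 first.
- by apply/measurable_EFinP; exact: measurable_funTS.
- by rewrite lee_fin ltW.
move=> /(congr1 (fun z => (k^-1)%:E * z)%E).
rewrite muleA -!EFinM mulVf ?gt_eqF// mul1e => <-.
by congr EFin; field; rewrite gt_eqF.
Qed.

(** The integral of a nonnegative function is a supremum over the simple functions below it, hence
    monotone for arbitrary functions. It is applied to a power of [derive1 lambda], for which
    measurability has not been established. *)
Lemma ge0_le_integral_any (D : set R) (f g : R -> \bar R) :
  (forall x, D x -> 0 <= f x)%E -> (forall x, D x -> f x <= g x)%E ->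
  (\int[mu]_(x in D) f x <= \int[mu]_(x in D) g x)%E.
Proof.
move=> f0 fg; have g0 x : D x -> (0 <= g x)%E by move=> Dx; exact: le_trans (f0 x Dx) (fg x Dx).
rewrite ge0_integralE// ge0_integralE//; apply: le_ereal_sup => _ [h hf <-].
exists h => // x; apply: (le_trans (hf x)); rewrite !patchE.
by case: ifPn => // /set_mem; exact: fg.
Qed.

End real_estimates.

(** * Pointwise and integral bounds for the derivative of [lambda] *)

Section lambda_derivative.
Context {R : realType}.
Implicit Types (x : R) (n : nat).
Notation mu := (@lebesgue_measure R).
Notation lam := (@lambda R).

Let quot n x := n.+1%:R * (lam (x + n.+1%:R^-1) - lam x).

Let hn_gt0 n : 0 < n.+1%:R^-1 :> R. Proof. by rewrite invr_gt0. Qed.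

Let quot_ge0 n x : 0 <= quot n x.
Proof.
by rewrite mulr_ge0// subr_ge0 lambda_nondecreasing// lerDl ltW.
Qed.

(* Where the limit defining [derive1] does not exist, its value is [0]. *)
Lemma derive1_lambdaP x :
  derive1 lam x = 0 \/ quot n x @[n --> \oo] --> derive1 lam x.
Proof.
rewrite /derive1; have [C|C] := pselect (cvg (h^-1 *: (lam (h + x) - lam x) @[h --> 0^'])).
  right; have /cvgr_dnbhsP := C => /(_ (fun n => n.+1%:R^-1)) H.
  have : (forall n, n.+1%:R^-1 != 0 :> R) /\ n.+1%:R^-1 @[n --> \oo] --> (0 : R).
    by split=> [n|]; [rewrite gt_eqF|exact: cvg_harmonic].
  move=> /H; apply: cvg_trans; apply: near_eq_cvg; apply: nearW => n.
  by rewrite /quot /= /GRing.scale/= invrK [x + _]addrC.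
by left; rewrite (dvgP C).
Qed.

Lemma derive1_lambda_ge0 x : 0 <= derive1 lam x.
Proof.
have [->//|H] := derive1_lambdaP x.
by apply: (cvgr_to_ge H); apply: nearW => n; exact: quot_ge0.
Qed.

(** [lambda_increment] bounds a difference quotient by the supremum of [(1 + |sinc u|) / 2] over its
    step; continuity of [sinc] at [x] keeps that within [d] of the value at [x] once the step is
    short. *)
Lemma derive1_lambda_le x : 0 < x -> derive1 lam x <= 2^-1 * (1 + `|sinc x|).
Proof.
move=> x0; have [->|H] := derive1_lambdaP x; first by rewrite mulr_ge0// addr_ge0.
apply/ler_addgt0Pr => d d0; apply: (cvgr_to_le H).
have cb : {for x, continuous (fun u => `|sinc u|)}.
  apply: (@continuous_comp _ _ _ (@sinc R) (fun z => `|z|)); first exact: sinc_continuous.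
  exact: norm_continuous.
have /cvgrPdist_lt/(_ d d0) [r /= r0 br] := cb.
have : \forall n \near \oo, n.+1%:R^-1 < r.
  have /cvgrPdist_lt/(_ r r0) := @cvg_harmonic R.
  by apply: filterS => n; rewrite sub0r normrN (gtr0_norm (hn_gt0 n)).
apply: filterS => n nr.
rewrite /quot mulrC -ler_pdivlMr// mulrC lerBlDl.
set B := 2^-1 * _ + d.
have B0 : 0 <= B by rewrite addr_ge0 ?(ltW d0)// mulr_ge0// addr_ge0.
have := @lambda_increment R x (x + n.+1%:R^-1) B x0.
rewrite addrAC subrr add0r; apply => //; first by rewrite ltrDl.
move=> u /andP[xu ux].
have := br u; rewrite /ball_/= distrC ger0_norm ?subr_ge0// => /(_ _).
have ur : u - x < r by rewrite ltrBlDl (le_lt_trans ux)// ltrD2l.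
move=> /(_ ur); rewrite ltr_norml => /andP[+ _].
by rewrite /B; lra.
Qed.

Let J n : set R := `](1 : R), n.+1%:R]%classic.

Let measurable_lambda : measurable_fun [set: R] lam.
Proof. by apply: nondecreasing_measurable => // s t; exact: lambda_nondecreasing. Qed.

Let mquot n : measurable_fun [set: R] (quot n).
Proof.
apply: (measurable_funM (measurable_cst _)); apply: measurable_funB => //.
by apply: (measurableT_comp measurable_lambda); exact: measurable_funD.
Qed.

(** With [N = n + 1] and [h = 1 / N], the integral of [lambda (x + h)] over []1, N]] is that of
    [lambda] over []1 + h, N + h]]. It exceeds the integral over []1, N]] by at most the
    contribution of []N, N + h]], which is at most [h] because [lambda <= 1]. Dividing by [h] gives
    1, uniformly in [n]. *)
Let integral_quot_le1 n : (\int[mu]_(x in J n) (quot n x)%:E <= 1)%E.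
Proof.
set N : R := n.+1%:R; set h := N^-1; have h0 : 0 < h by exact: hn_gt0.
have N1 : 1 <= N by rewrite ler1n.
have ml : measurable_fun [set: R] (fun x => (lam x)%:E).
  by apply/measurable_EFinP.
have mJ : measurable (J n) by exact: measurable_itv.
have l0 x : (0 <= (lam x)%:E)%E by rewrite lee_fin lambda_ge0.
have muJ (a b : R) : a <= b -> (mu `]a, b]%classic = (b - a)%:E)%E.
  rewrite le_eqVlt lebesgue_measure_itv/= lte_fin => /predU1P[->|->].
    by rewrite ltxx subrr.
  by rewrite -EFinB.
have ile (A : set R) : measurable A -> (\int[mu]_(x in A) (lam x)%:E <= mu A)%E.
  move=> mA; apply: (@le_trans _ _ (\int[mu]_(x in A) 1)%E).
    apply: ge0_le_integral => //; first exact: measurable_funTS.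
    by move=> x _; rewrite lee_fin lambda_le1.
  have -> : (\int[mu]_(x in A) 1 = 1 * mu A)%E by exact: integral_cst.
  by rewrite mul1e.
set I := (\int[mu]_(x in J n) (lam x)%:E)%E.
have I0 : (0 <= I)%E by apply: integral_ge0 => x _.
have Ifin : I \is a fin_num.
  rewrite ge0_fin_numE//; apply: le_lt_trans (ile _ mJ) _.
  by rewrite muJ// ltry.
have mq : measurable_fun (J n) (fun x => (quot n x)%:E).
  by apply/measurable_EFinP; exact: measurable_funTS.
have shift : (\int[mu]_(x in J n) (lam (x + h))%:E <= I + h%:E)%E.
  pose K : set R := `](1 + h), (N + h)]%classic.
  have mK : measurable K by exact: measurable_itv.
  have := @ge0_integral_preserving R (fun x => x + h) (fun x => (lam x)%:E) K
    (preserves_lebesgue_shift h) mK (measurable_funTS ml).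
  have -> : (fun x => x + h) @^-1` K = J n.
    by apply/seteqP; split => x /=; rewrite /J /K /= !in_itv/= ltrD2r lerD2r.
  move=> -> //.
  pose K' : set R := `]N, (N + h)]%classic.
  have mK' : measurable K' by exact: measurable_itv.
  apply: (@le_trans _ _ (\int[mu]_(x in J n `|` K') (lam x)%:E)%E).
    apply: ge0_subset_integral => //; first exact: measurableU.
      exact: measurable_funTS.
    move=> x; rewrite /K /J /K' /= !in_itv/= => /andP[x1 x2].
    by have [xN|xN] := leP x N; [left; apply/andP; split; [lra|]|right].
  rewrite ge0_integral_setU//; last 2 first.
  - exact: measurable_funTS.
  - apply/disj_setPS => x; rewrite /J /K' /= !in_itv/= => -[/andP[_ x1] /andP[x2 _]].
    by rewrite -/N in x1; lra.
  rewrite leeD2l//; apply: (le_trans (ile _ mK')).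
  by rewrite muJ; [rewrite lee_fin; lra|lra].
have split_ : (\int[mu]_(x in J n) (lam (x + h))%:E =
    I + h%:E * \int[mu]_(x in J n) (quot n x)%:E)%E.
  have hq : (\int[mu]_(x in J n) (h%:E * (quot n x)%:E) =
      h%:E * \int[mu]_(x in J n) (quot n x)%:E)%E.
    apply: ge0_integralZl => //; last by rewrite lee_fin ltW.
    by move=> x _; rewrite lee_fin quot_ge0.
  rewrite -hq.
  rewrite -ge0_integralD//.
  - apply: eq_integral => x _; rewrite -EFinM -EFinD /quot mulrA -/N -/h.
    by rewrite mulVf ?gt_eqF// ?mul1r ?subrKC//; lra.
  - exact: measurable_funTS.
  - by move=> x _; rewrite mule_ge0 ?lee_fin ?quot_ge0// ltW.
  - exact: measurable_funeM.
move: shift; rewrite split_ leeD2lE// => H.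
rewrite -(@lee_pmul2l _ h%:E)//; first by rewrite mule1.
Qed.

Let M n x : \bar R := ((fun x => (quot n x)%:E) \_ (J n)) x.

Let M_ge0 n x : (0 <= M n x)%E.
Proof. by rewrite /M patchE; case: ifP => // _; rewrite lee_fin quot_ge0. Qed.

Let mM n : measurable_fun [set: R] (M n).
Proof.
have mJ : measurable (J n) by exact: measurable_itv.
apply/(measurable_restrictT _ mJ).
by apply/measurable_EFinP; exact: measurable_funTS.
Qed.

Let limn_einf_ge0 (u : nat -> \bar R) : (forall n, 0 <= u n)%E -> (0 <= limn_einf u)%E.
Proof.
move=> u0; rewrite limn_einf_lim; apply: lime_ge; first exact: is_cvg_einfs.
by apply: nearW => n; apply/ereal_infP => _ [k _ <-]; exact: u0.
Qed.

Let limn_einf_le1 (u : nat -> \bar R) : (forall n, u n <= 1)%E -> (limn_einf u <= 1)%E.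
Proof.
move=> u1; rewrite limn_einf_lim; apply: lime_le; first exact: is_cvg_einfs.
apply: nearW => n; apply: (le_trans _ (u1 n)); apply: ereal_inf_lbound.
by exists n => /=.
Qed.

(* An integrable majorant for [lambda'] beyond [1]: Fatou's lemma applied to
   difference quotients, whose integrals telescope. *)
Lemma derive1_lambda_majorant : exists g : R -> \bar R,
  [/\ measurable_fun [set: R] g, forall x, (0 <= g x)%E,
      forall x, 1 < x -> ((derive1 lam x)%:E <= g x)%E &
      (\int[mu]_x g x <= 1)%E].
Proof.
exists (fun x => limn_einf (M^~ x)); split.
- have -> : (fun x => limn_einf (M^~ x)) = (fun x => - limn_esup (fun n => - M n x))%E.
    by apply/funext => x; rewrite -limn_einfN; congr limn_einf; apply/funext => n /=; rewrite oppeK.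
  apply: measurableT_comp => //; apply: measurable_fun_limn_esup => n.
  by apply: measurableT_comp => //; exact: mM.
- by move=> x; exact: limn_einf_ge0.
- move=> x x1; have [->|H] := derive1_lambdaP x; first exact: limn_einf_ge0.
  have HM : M n x @[n --> \oo] --> (derive1 lam x)%:E.
    have : (quot n x)%:E @[n --> \oo] --> (derive1 lam x)%:E.
      by apply: cvg_EFin => //; exact: nearW.
    apply: cvg_trans; apply: near_eq_cvg.
    near=> n; rewrite /M patchE mem_set// /J /= in_itv/= x1/=.
    near: n; have := @nbhs_infty_ger R x.
    by apply: filterS => n xn; apply: (le_trans xn); rewrite ler_nat.
  by rewrite (cvg_limn_einf_sup HM).1.
- have mM' n : measurable_fun [set: R] (M n) by exact: mM.
  apply: (le_trans (fatou mu measurableT mM' (fun n x _ => M_ge0 n x))).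
  apply: limn_einf_le1 => n; rewrite /M -integral_mkcond.
  exact: integral_quot_le1.
Unshelve. all: by end_near.
Qed.

End lambda_derivative.

(** * Elementary estimates for exponentials and powers *)

Section exponential_estimates.
Context {R : realType}.
Implicit Types (A B q d c p u : R).

Lemma expR_le_add B : expR B <= 1 + B * expR B.
Proof.
have := expR_ge1Dx (- B); rewrite -(ler_pM2r (expR_gt0 B)) -expRD addNr expR0.
by lra.
Qed.

Lemma expR_ge_sqr u : 0 <= u -> u ^+ 2 / 2 <= expR u.
Proof. by move=> u0; have := expR_ge1Dxn 1 u0; rewrite !factS fact0 !muln1; lra. Qed.

(* With [A = q (pi x)^2 / 24], the second-order error in the exponent is
   [B = q (pi x)^4 / 480 = 6/5 A^2 / q]. *)
Lemma expR_perturbation A B q : 0 < q -> 0 <= A -> B <= 4 / 5 * A ->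
  B = 6 / 5 * A ^+ 2 / q ->
  expR (- A + B) <= expR (- A) + 6 * (40 / q) * expR (- (A / 10)).
Proof.
move=> q0 A0 BA BE.
have B0 : 0 <= B by rewrite BE !mulr_ge0 ?sqr_ge0 ?invr_ge0// ltW.
have E1 : expR (- A + B) <= expR (- A) + B * expR (- A + B).
  rewrite expRD mulrCA -[X in X + _]mulr1 -mulrDr ler_wpM2l ?expR_ge0//.
  exact: expR_le_add.
apply: (le_trans E1); rewrite lerD2l.
apply: (@le_trans _ _ (B * expR (- (A / 5)))).
  by rewrite ler_wpM2l// ler_expR; lra.
(* One half of the decay absorbs the factor [A ^+ 2] through [expR_ge_sqr] at [A / 10], the other
   half is kept so that the error term remains integrable. The constant comes from [6 / 5 * A ^+ 2 =
   6 * 40 * ((A / 10) ^+ 2 / 2)]. *)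
have -> : - (A / 5) = - (A / 10) + - (A / 10) by field.
rewrite expRD mulrA ler_wpM2r ?expR_ge0// expRN ler_pdivrMr ?expR_gt0//.
have u0 : 0 <= A / 10 by rewrite divr_ge0.
have := expR_ge_sqr u0; rewrite BE => H.
have -> : 6 / 5 * A ^+ 2 / q = 6 * (40 / q) * ((A / 10) ^+ 2 / 2) by field; rewrite gt_eqF.
by rewrite ler_wpM2l// mulr_ge0// divr_ge0// ltW.
Qed.

(** One factor [d] is kept apart: in the application [d] is [lambda'] beyond 1, whose integral is
    controlled, and [c] is [3 / 4]. *)
Lemma powR_le_linear d c p : 0 <= d -> d <= c -> 1 < p -> d `^ p <= c `^ (p - 1) * d.
Proof.
move=> d0 dc p1; have [->|dn0] := eqVneq d 0.
  by rewrite powR0 ?mulr0// gt_eqF//; lra.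
have -> : d `^ p = d `^ (p - 1) * d.
  by rewrite -[X in _ * X]powRr1// -powRD ?subrK// dn0 implybT.
rewrite ler_wpM2r// ge0_ler_powR ?nnegrE//; first by lra.
exact: le_trans dc.
Qed.

Lemma powR_three_quarters q : 4 <= q -> (3 / 4) `^ (q / 2 - 1) <= 2 * (16 / q) ^+ 2.
Proof.
move=> q4; have q0 : 0 < q by lra.
apply: (@le_trans _ _ (expR (- (1 / 4)) `^ (q / 2 - 1))).
  apply: ge0_ler_powR; rewrite ?nnegrE ?expR_ge0//; first by lra.
  by have := expR_ge1Dx (- (1 / 4) : R); lra.
rewrite -expRM; apply: (@le_trans _ _ (expR (- (q / 16)))).
  by rewrite ler_expR; lra.
have r0 : 0 < 2 * (16 / q) ^+ 2 by rewrite mulr_gt0// exprn_gt0// divr_gt0.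
rewrite expRN -[leRHS]invrK lef_pV2 ?posrE ?expR_gt0 ?invr_gt0//.
have q16 : 0 <= q / 16 by lra.
apply: le_trans (expR_ge_sqr q16).
by rewrite le_eqVlt; apply/orP; left; apply/eqP; field; rewrite gt_eqF.
Qed.

Lemma powR_minus_three_halves q : 0 < q -> q `^ (- (3 / 2)) = (q * Num.sqrt q)^-1.
Proof.
move=> q0; rewrite powRN; congr (_^-1).
have -> : 3 / 2 = 1 + 2^-1 :> R by field.
by rewrite powRD ?gt_eqF ?implybT// powRr1 ?(ltW q0)// powR12_sqrt ?(ltW q0).
Qed.

End exponential_estimates.

(** * Gaussian majorant and the final bound *)

Section main_estimate.
Context {R : realType}.
Implicit Types (q x : R).
Notation mu := (@lebesgue_measure R).

(** Scaled so that [(k q * x) ^+ 2] is [q / 2] times [(pi * x) ^+ 2 / 12], the leading term of the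
    exponent. *)
Let k q : R := pi * Num.sqrt (q / 24).

Let k_gt0 q : 0 < q -> 0 < k q.
Proof. by move=> q0; rewrite mulr_gt0 ?pi_gt0// sqrtr_gt0 divr_gt0. Qed.

Let k_sqr q x : 0 < q -> (k q * x) ^+ 2 = q * (pi * x) ^+ 2 / 24.
Proof.
move=> q0; rewrite /k !exprMn sqr_sqrtr; last by rewrite divr_ge0// ltW.
by move: (@pi R) => p; field.
Qed.

Let gauss_mass q : 0 < q -> Num.sqrt pi / (2 * k q) = Num.sqrt (6 / (pi * q)).
Proof.
move=> q0; have k0 := k_gt0 q0; have pi0 := @pi_gt0 R.
have <- : (Num.sqrt pi / (2 * k q)) ^+ 2 = 6 / (pi * q).
  have := k_sqr 1 q0; rewrite !mulr1 => E.
  rewrite expr_div_n exprMn E sqr_sqrtr ?(ltW pi0)//.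
  by move: (@pi R) pi0 => p p0; field; rewrite !gt_eqF.
by rewrite sqrtr_sqr ger0_norm// divr_ge0 ?sqrtr_ge0// mulr_ge0// ltW.
Qed.

(** The right-hand side of [expR_perturbation] for [A = (k q * x) ^+ 2]; the exponent [A / 10] makes
    the error a Gaussian wider by the factor [Num.sqrt 10]. *)
Let H q x : R := expR (- (k q * x) ^+ 2) +
  6 * (40 / q) * expR (- (k q / Num.sqrt 10 * x) ^+ 2).

Let near_bound q x : 4 <= q -> 0 < x -> x <= 1 ->
  derive1 (@lambda R) x `^ (q / 2) <= H q x.
Proof.
move=> q4 x0 x1; have q0 : 0 < q by lra.
have pi0 := @pi_gt0 R.
set y := pi * x; have y0 : 0 < y by rewrite mulr_gt0.
have y4 : y <= 4.
  rewrite -[4]mulr1 ler_pM ?(ltW x0) ?pi_ge0//.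
  by have := @pihalf_lt2 R; lra.
pose A := q * y ^+ 2 / 24; pose B := q * y ^+ 4 / 480.
have A0 : 0 <= A by rewrite divr_ge0 ?mulr_ge0 ?sqr_ge0// ltW.
have y16 : y ^+ 2 <= 16.
  have -> : 16 = 4 ^+ 2 :> R by ring.
  by rewrite !expr2; apply: ler_pM => //; exact: ltW.
(* The quotient [B / A] is [y ^+ 2 / 20], at most [16 / 20]; this is where [x <= 1] and [pi <= 4]
   enter. *)
have BA : B <= 4 / 5 * A.
  have : q * y ^+ 2 * y ^+ 2 <= q * y ^+ 2 * 16.
    by rewrite ler_wpM2l// mulr_ge0 ?sqr_ge0// ltW.
  by rewrite /A /B; lra.
have BE : B = 6 / 5 * A ^+ 2 / q by rewrite /A /B; field; rewrite gt_eqF.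
have HE : H q x = expR (- A) + 6 * (40 / q) * expR (- (A / 10)).
  rewrite /H k_sqr// -/y -/A; congr (_ + _ * expR (- _)).
  rewrite mulrAC exprMn k_sqr// exprVn sqr_sqrtr//.
rewrite HE; apply: le_trans (expR_perturbation q0 A0 BA BE).
apply: (@le_trans _ _ (expR (- y ^+ 2 / 12 + y ^+ 4 / 240) `^ (q / 2))).
  apply: ge0_ler_powR; rewrite ?nnegrE ?expR_ge0 ?derive1_lambda_ge0//.
    by rewrite divr_ge0// ltW.
  by apply: (le_trans (derive1_lambda_le x0)); exact: sinc_le_near.
rewrite -expRM ler_expR le_eqVlt; apply/orP; left; apply/eqP.
by rewrite /A /B; field.
Qed.

Let far_bound q x : 4 <= q -> 1 < x ->
  derive1 (@lambda R) x `^ (q / 2) <= 2 * (16 / q) ^+ 2 * derive1 (@lambda R) x.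
Proof.
move=> q4 x1; have d0 := derive1_lambda_ge0 x.
have d34 : derive1 (@lambda R) x <= 3 / 4.
  apply: (le_trans (derive1_lambda_le _)); first by lra.
  by apply: sinc_le_far; exact: ltW.
apply: (le_trans (powR_le_linear d0 d34 _)); first by lra.
by rewrite ler_wpM2r// powR_three_quarters.
Qed.

Let measurable_H q : measurable_fun [set: R] (H q).
Proof.
have mg (c : R) : measurable_fun [set: R] (fun x => expR (- (c * x) ^+ 2)).
  by apply: (measurableT_comp (@measurable_gauss_fun R)); exact: measurable_funM.
by apply: measurable_funD => //; apply: measurable_funM.
Qed.

Let H_ge0 q x : 0 < q -> 0 <= H q x.
Proof. by move=> q0; rewrite addr_ge0 ?expR_ge0// mulr_ge0 ?expR_ge0// mulr_ge0// divr_ge0// ltW. Qed.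

Let integral_H q : 0 < q ->
  (\int[mu]_(x in `[0%R, +oo[) (H q x)%:E =
   (Num.sqrt (6 / (pi * q)) + 6 * (40 / q) * (Num.sqrt 10 * Num.sqrt (6 / (pi * q))))%:E)%E.
Proof.
move=> q0; have s10 : 0 < Num.sqrt 10 :> R by rewrite sqrtr_gt0.
have k0 := k_gt0 q0; have k'0 : 0 < k q / Num.sqrt 10 by rewrite divr_gt0.
have mg (c : R) : measurable_fun [set: R] (fun x => expR (- (c * x) ^+ 2)).
  by apply: (measurableT_comp (@measurable_gauss_fun R)); exact: measurable_funM.
have mg' (c : R) (D : set R) : measurable_fun D (fun x => (expR (- (c * x) ^+ 2))%:E).
  by apply/measurable_EFinP; exact: measurable_funTS.
have c0 : 0 <= 6 * (40 / q) by rewrite mulr_ge0// divr_ge0// ltW.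
transitivity (\int[mu]_(x in `[0%R, +oo[) ((expR (- (k q * x) ^+ 2))%:E +
    (6 * (40 / q))%:E * (expR (- (k q / Num.sqrt 10 * x) ^+ 2))%:E))%E.
  by apply: eq_integral => x _; rewrite -EFinM -EFinD.
rewrite ge0_integralD//; last 3 first.
- exact: mg'.
- by move=> x _; rewrite -EFinM lee_fin mulr_ge0 ?expR_ge0.
- by apply: measurable_funeM; exact: mg'.
rewrite ge0_integralZl//; last exact: mg'.
rewrite !integral0y_gauss_scale// -EFinM -EFinD -gauss_mass//.
by congr (_ + _ * _)%:E; field; rewrite !gt_eqF.
Qed.

(** The bounds for [x <= 1] and for [x > 1] are added instead of glued: both are nonnegative, so
    their sum is a majorant on the whole half-line, over which the Gaussians integrate exactly. *)
Lemma Lambda_le q : 4 <= q -> (Lambda q <=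
  (Num.sqrt (6 / (pi * q)) + 6 * (40 / q) * (Num.sqrt 10 * Num.sqrt (6 / (pi * q))) +
   2 * (16 / q) ^+ 2)%:E)%E.
Proof.
move=> q4; have q0 : 0 < q by lra.
have [g [mg g0 gd g1]] := @derive1_lambda_majorant R.
have c0 : 0 <= 2 * (16 / q) ^+ 2 by rewrite mulr_ge0// sqr_ge0.
apply: (@le_trans _ _ (\int[mu]_(x in `]0%R, +oo[)
    ((H q x)%:E + (2 * (16 / q) ^+ 2)%:E * g x))%E).
  apply: ge0_le_integral_any => x; first by rewrite lee_fin powR_ge0.
  rewrite /= in_itv/= andbT => x0; have [x1|x1] := leP x 1.
    apply: (@le_trans _ _ (H q x)%:E); first by rewrite lee_fin near_bound.
    by rewrite leeDl// mule_ge0.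
  apply: (@le_trans _ _ ((2 * (16 / q) ^+ 2)%:E * g x)%E).
    apply: (@le_trans _ _ ((2 * (16 / q) ^+ 2)%:E * (derive1 (@lambda R) x)%:E)%E).
      by rewrite -EFinM lee_fin far_bound.
    by rewrite lee_wpmul2l// gd.
  by rewrite leeDr// lee_fin H_ge0.
have mH' (D : set R) : measurable_fun D (fun x => (H q x)%:E).
  by apply/measurable_EFinP; exact: measurable_funTS.
have mg' (D : set R) : measurable_fun D g by exact: measurable_funTS.
rewrite ge0_integralD//; last 4 first.
- by move=> x _; rewrite lee_fin H_ge0.
- exact: mH'.
- by move=> x _; rewrite mule_ge0.
- by apply: measurable_funeM; exact: mg'.
rewrite EFinD leeD//.
  rewrite -integral_H//; apply: ge0_subset_integral => //.
  - exact: mH'.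
  - by move=> x _; rewrite lee_fin H_ge0.
  - by apply: subset_itvr; rewrite bnd_simp.
rewrite ge0_integralZl//; last exact: mg'.
rewrite -[leRHS]mule1 lee_wpmul2l//; apply: le_trans g1.
by apply: ge0_subset_integral.
Qed.

End main_estimate.

Theorem corollary1 (R : realType) :
  exists C q0 : R, [/\ 0 < C, 2 < q0 &
    forall q : R, q0 <= q ->
      (Lambda q <= (Num.sqrt (6 / (pi * q)) + C * q `^ (- (3 / 2)))%:E)%E].
Proof.
(* The summand [6 * 40 * 8] bounds the error Gaussian, with [Num.sqrt 10 <= 4] and [Num.sqrt (6 /
   (pi * q)) <= 2 / Num.sqrt q]. The summand [2 * 16 ^+ 2] is the tail, where [q ^ -2] is at most
   [q ^ (- 3 / 2)]. The threshold 4 is that of [Lambda_le]. *)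
exists (6 * 40 * 8 + 2 * 16 ^+ 2), 4; split=> [||q q4]; [lra|lra|].
have q0 : 0 < q by lra.
apply: (le_trans (Lambda_le q4)).
rewrite lee_fin -addrA lerD2l powR_minus_three_halves//.
have s0 : 0 < Num.sqrt q by rewrite sqrtr_gt0.
have sq : Num.sqrt q ^+ 2 = q by rewrite sqr_sqrtr// ltW.
have S10 : Num.sqrt 10 <= 4 :> R.
  have -> : 4 = Num.sqrt (4 ^+ 2) :> R by rewrite sqrtr_sqr ger0_norm.
  by rewrite ler_sqrt ?exprn_gt0//; lra.
have Sq : Num.sqrt (6 / (pi * q)) <= 2 / Num.sqrt q.
  have -> : 2 / Num.sqrt q = Num.sqrt ((2 / Num.sqrt q) ^+ 2).
    by rewrite sqrtr_sqr ger0_norm// divr_ge0// ltW.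
  rewrite ler_sqrt ?exprn_gt0 ?divr_gt0// expr_div_n sq.
  rewrite ler_pdivrMr ?mulr_gt0 ?pi_gt0//.
  have -> : 2 ^+ 2 / q * (pi * q) = 4 * pi.
    by move: (@pi R) => p; field; rewrite gt_eqF.
  by have := @pi_ge2 R; lra.
have -> : (6 * 40 * 8 + 2 * 16 ^+ 2) * (q * Num.sqrt q)^-1 =
    6 * (40 / q) * (4 * (2 / Num.sqrt q)) + 2 * (16 ^+ 2 * (q * Num.sqrt q)^-1).
  by field; rewrite !gt_eqF.
rewrite lerD//.
  have c0 : 0 <= 6 * (40 / q) by rewrite mulr_ge0// divr_ge0// ltW.
  apply: (ler_wpM2l c0).
  by apply: ler_pM => //; exact: sqrtr_ge0.
rewrite expr_div_n ler_wpM2l// ler_wpM2l ?sqr_ge0//.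
rewrite lef_pV2 ?posrE ?exprn_gt0 ?mulr_gt0//.
rewrite expr2 ler_wpM2l ?(ltW q0)//.
by rewrite -[leRHS]sq expr2 ler_peMr ?(ltW s0)// -[1]sqrtr1 ler_sqrt//; lra.
Qed.
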